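(* Let $X$ be a centered infinitely divisible random vector in $\mathbb{R}^d$ with finite second moment. If $0\in D_X$, then for every $t\in\mathbb{R}^d$, $$p_{D_X}(t)\le C_X(t)\le\frac{b_X(t)}{3}.$$ The factor $1/3$ in the upper bound is best possible over centered infinitely divisible laws with bounded positive jumps; that is, there is no constant $k<1/3$ such that $C_X(t)\le k\,b_X(t)$ holds for all such laws (with finite second moment) and all $t$.
   Context: $X$ is a centered infinitely divisible random vector in $\mathbb{R}^d$ with finite second moment, covariance matrix $\Sigma$ and Lévy measure $\nu$; $K_X(t):=\log\mathbb{E}e^{\langle t,X\rangle}$ (value $+\infty$ allowed) and $V_X(t):=t^\top\Sigma t$. Directional (radial) pole: if $V_X(t)>0$, $C_X(t)\in[0,\infty]$ is the infimum of all $c\in[0,\infty)$ such that $$K_X(st)\le\frac{V_X(t)s^2}{2(1-cs)}\qquad\text{for all }0\le s<1/c,$$ with $1/0=\infty$ and $\inf\emptyset=\infty$. If $V_X(t)=0$, $C_X(t):=0$. $D_X$ is the interior of the effective domain $\mathcal{E}_X=\{t\in\mathbb{R}^d:K_X(t)<\infty\}$, which is convex. When $0\in D_X$, its Minkowski functional is $p_{D_X}(t)=\inf\{a>0:t\in aD_X\}$. The positive jump radius is $b_X(t)=\sup_{x\in\operatorname{supp}\nu}\langle t,x\rangle_+\in[0,\infty]$ with $z_+=\max\{z,0\}$ (the support function of $\operatorname{supp}\nu\cup\{0\}$; it equals $0$ if $\nu=0$). Bounded positive jumps in direction $t$ means $b_X(t)<\infty$. *)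

(* Defs.v *)
From HB Require Import structures.
From mathcomp Require Import all_boot all_order all_algebra.
From mathcomp Require Import complex.
From mathcomp Require Import all_classical all_reals all_analysis.

Set Implicit Arguments.
Unset Strict Implicit.
Unset Printing Implicit Defensive.

Import Order.TTheory GRing.Theory Num.Theory.
Import numFieldNormedType.Exports.

Local Open Scope classical_set_scope.
Local Open Scope complex_scope.
Local Open Scope ring_scope.

(* Vectors of R^d are row vectors 'rV[R]_d, with the Borel sigma-algebra of the
   library's (sup-norm, hence Euclidean) topology. *)
Section borel_matrix.
Context (R : realType) (m n : nat).

Definition borel_matrix_display : measure_display. Proof. exact. Qed.

Let borel0 : <<s @open 'M[R]_(m, n) >> set0.
Proof. exact: sigma_algebra0. Qed.

Let borelC A : <<s @open 'M[R]_(m, n) >> A -> <<s @open 'M[R]_(m, n) >> (~` A).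
Proof. exact: sigma_algebraC. Qed.

Let borel_bigcup (F : (set 'M[R]_(m, n))^nat) :
  (forall i, <<s @open 'M[R]_(m, n) >> (F i)) ->
  <<s @open 'M[R]_(m, n) >> (\bigcup_i F i).
Proof. exact: sigma_algebra_bigcup. Qed.

HB.instance Definition _ := @isMeasurable.Build borel_matrix_display
  'M[R]_(m, n) <<s @open 'M[R]_(m, n) >> borel0 borelC borel_bigcup.

End borel_matrix.

Section euclidean.
Context (R : realType) (d : nat).

Definition dotv (t x : 'rV[R]_d) : R := (t *m x^T) 0 0.

Definition quad (A : 'M[R]_d) (t : 'rV[R]_d) : R := (t *m A *m t^T) 0 0.

Definition minkowski_functional (D : set 'rV[R]_d) (t : 'rV[R]_d) : \bar R :=
  ereal_inf [set a%:E | a in [set a : R | 0 < a /\ [set a *: u | u in D] t]].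

End euclidean.

Section infinite_divisibility.
Context (R : realType) (d : nat).

(* n-fold convolution power, through
   (mu * rho)(A) = \int rho (A - x) mu(dx). *)
Fixpoint conv_pow (mu : probability 'rV[R]_d R) (n : nat) (A : set 'rV[R]_d)
    : \bar R :=
  if n is n'.+1 then (\int[mu]_x conv_pow mu n' [set y : 'rV[R]_d | A (x + y)%R])%E
  else \d_(0 : 'rV[R]_d) A.

Definition infinitely_divisible (mu : probability 'rV[R]_d R) : Prop :=
  forall n, (0 < n)%N -> exists mu_n : probability 'rV[R]_d R,
    forall A, measurable A -> mu A = conv_pow mu_n n A.

End infinite_divisibility.

Section levy_khintchine.
Context (R : realType) (d : nat).

Definition cexp (z : R[i]) : R[i] :=
  (expR (complex.Re z) * cos (complex.Im z)) +i*
  (expR (complex.Re z) * sin (complex.Im z)).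

(* E exp(i <t, X>) *)
Definition char_fun (mu : probability 'rV[R]_d R) (t : 'rV[R]_d) : R[i] :=
  (\int[mu]_x cos (dotv t x)) +i* (\int[mu]_x sin (dotv t x)).

(* i <t, g> - <t, A t> / 2
     + \int (exp(i <t, x>) - 1 - i <t, x> 1_{|x| <= 1}) nu(dx),
   split into real and imaginary parts; |x| is the Euclidean norm. *)
Definition levy_exponent (g : 'rV[R]_d) (A : 'M[R]_d)
    (nu : {measure set 'rV[R]_d -> \bar R}) (t : 'rV[R]_d) : R[i] :=
  (- quad A t / 2 + \int[nu]_x (cos (dotv t x) - 1)) +i*
  (dotv t g + \int[nu]_x (sin (dotv t x)
                 - dotv t x * \1_[set x | dotv x x <= 1] x)).

Definition levy_measure (mu : probability 'rV[R]_d R)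
    (nu : {measure set 'rV[R]_d -> \bar R}) : Prop :=
  [/\ nu [set 0] = 0%E,
      (\int[nu]_x (Num.min 1 (dotv x x))%:E < +oo)%E &
      exists (g : 'rV[R]_d) (A : 'M[R]_d),
        [/\ A^T = A, forall t, 0 <= quad A t &
            forall t, char_fun mu t = cexp (levy_exponent g A nu t)]].

Definition msupport (nu : {measure set 'rV[R]_d -> \bar R}) : set 'rV[R]_d :=
  [set x | forall U, open U -> U x -> (0 < nu U)%E].

(* 0 is adjoined to the support so that the supremum is 0 when nu = 0. *)
Definition jump_radius (nu : {measure set 'rV[R]_d -> \bar R}) (t : 'rV[R]_d)
    : \bar R :=
  ereal_sup [set (Num.max (dotv t x) 0)%:E | x in msupport nu `|` [set 0]].

End levy_khintchine.

Section random_vector.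
Context (R : realType) (d : nat) (disp : measure_display)
  (Omega : measurableType disp) (P : probability Omega R).
Implicit Type X : {RV P >-> 'rV[R]_d}.

Definition centered X : Prop := forall i, ('E_P[fun w => X w 0%R i] = 0)%E.

Definition finite_second_moment X : Prop :=
  ('E_P[fun w => dotv (X w) (X w)] < +oo)%E.

Definition covmx X : 'M[R]_d :=
  \matrix_(i, j) fine (covariance P (fun w => X w 0 i) (fun w => X w 0 j)).

Definition variance_form X (t : 'rV[R]_d) : R := quad (covmx X) t.

Definition log_mgf X (t : 'rV[R]_d) : \bar R :=
  lne ('E_P[fun w => expR (dotv t (X w))])%E.

Definition eff_domain X : set 'rV[R]_d := [set t | (log_mgf X t < +oo)%E].

Definition mgf_domain X : set 'rV[R]_d := (eff_domain X)°.

(* The inverse c%:E^-1 is the one of \bar R, for which 0^-1 = +oo. *)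
Definition pole_bound X (t : 'rV[R]_d) (c : R) : Prop :=
  forall s : R, 0 <= s -> (s%:E < c%:E^-1)%E ->
    (log_mgf X (s *: t)
       <= (variance_form X t * s ^+ 2 / (2 * (1 - c * s)))%:E)%E.

Definition radial_pole X (t : 'rV[R]_d) : \bar R :=
  if 0 < variance_form X t then
    ereal_inf [set c%:E | c in [set c : R | 0 <= c /\ pole_bound X t c]]
  else 0%E.

End random_vector.

(* Main.v *)
(* Fix t, let Y = <t, X> have variance V, and suppose <t, x> <= b on the support
   of nu. Differentiating the Levy-Khintchine formula gives a Stein identity for
   E[Y exp (i q Y)]. Exponential moments of Y are not known to be finite yet, so
   the identity is averaged over q = - h U, where U is a sum of n independent
   Laplace variables: this replaces exp (i q Y) by the bounded test function
   F_n(Y) = (1 + (1 - h Y)^2)^-n and yields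
   E[Y F_n(Y)] <= V (exp (n h b) - 1) / b * E[F_n(Y)].
   As 2^n F_n(x) - 2^(n-1) F_(n-1)(x) <= h x 2^n F_n(x), a discrete Gronwall
   argument with h = s / n, n -> oo, gives Bennett's inequality
   E[exp (s Y)] <= exp (V (exp (s b) - 1 - s b) / b^2), and the upper bound
   follows from exp z - 1 - z <= z^2 / (2 (1 - z / 3)).
   The lower bound holds because the effective domain is convex: if it contains
   s t for all s < 1 / c, then its interior, which contains 0, does as well.
   For sharpness take X = (N - 1) e with N of Poisson law of mean 1 and e a unit
   vector: then K_X(s e) = exp s - 1 - s and b = 1, and the term s^3 / 6 of the
   expansion at 0 excludes every pole bound c < 1 / 3. *)
From HB Require Import structures.
Require Import Defs.
From mathcomp Require Import all_boot all_order all_algebra.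
From mathcomp Require Import complex.
From mathcomp Require Import all_classical all_reals all_analysis.
From mathcomp Require Import measurable_realfun.
From mathcomp Require Import ring lra.
Set Implicit Arguments.
Unset Strict Implicit.
Unset Printing Implicit Defensive.
Import Order.TTheory GRing.Theory Num.Theory.
Import numFieldNormedType.Exports.
Local Open Scope classical_set_scope.
Local Open Scope ring_scope.

(** The centre [1] in [1 - h Y] is what lets bounded test functions replace exponentials. The slope
    of [log (1 + r^2)] is at most 1, with equality at [r = 1]. Hence moving the argument of [F_n] by
    [t >= 0] multiplies it by at most [exp (n h t)], the property of [exp (n h x)] on which the
    estimate of the jump term rests. Moreover [1 + (1 - h x)^2 = 2 (1 - h x + (h x)^2 / 2)] agrees
    with [2 exp (- h x)] to second order, whence the factor [2^n]. Laplace variables have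
    characteristic function [1 / (1 + r^2)], so averaging [cos (U (1 - h Y))] over [U] yields
    [F_n(Y)] exactly. A Lévy measure integrates only [min (1, |x|^2)] by definition. Large jumps are
    controlled by the second moment of [X]: the modulus of the characteristic function near 0 and
    Fatou's lemma give [a + \int <t, x>^2 dnu <= V], with [a] the Gaussian variance in direction
    [t]. This also makes the exponent differentiable. Bennett's inequality divides by [b], so a
    vanishing jump radius is reached as a limit of positive [b]. *)

(** * Derivative rules and elementary inequalities *)

Lemma is_deriveD_fun (R : realType) (f g : R -> R) (x a b : R) :
  is_derive x 1 f a -> is_derive x 1 g b ->
  is_derive x 1 (fun y => f y + g y) (a + b).
Proof. by move=> df dg; exact: is_deriveD. Qed.

Lemma is_deriveN_fun (R : realType) (f : R -> R) (x a : R) :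
  is_derive x 1 f a -> is_derive x 1 (fun y => - f y) (- a).
Proof. by move=> df; exact: is_deriveN. Qed.

Lemma is_deriveB_fun (R : realType) (f g : R -> R) (x a b : R) :
  is_derive x 1 f a -> is_derive x 1 g b ->
  is_derive x 1 (fun y => f y - g y) (a - b).
Proof. by move=> df dg; exact: is_deriveB. Qed.

Lemma is_deriveM_fun (R : realType) (f g : R -> R) (x a b : R) :
  is_derive x 1 f a -> is_derive x 1 g b ->
  is_derive x 1 (fun y => f y * g y) (a * g x + f x * b).
Proof.
move=> df dg; apply: (is_derive_eq (is_deriveM df dg)).
by rewrite /GRing.scale/= addrC [X in X + _]mulrC.
Qed.

Lemma is_derive_expR_fun (R : realType) (f : R -> R) (x a : R) :
  is_derive x 1 f a -> is_derive x 1 (fun y => expR (f y)) (expR (f x) * a).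
Proof. by move=> df; exact: (@is_derive1_comp R expR f). Qed.

Lemma is_derive_cos_fun (R : realType) (f : R -> R) (x a : R) :
  is_derive x 1 f a -> is_derive x 1 (fun y => cos (f y)) (- sin (f x) * a).
Proof. by move=> df; exact: (@is_derive1_comp R cos f). Qed.

Lemma is_derive_sin_fun (R : realType) (f : R -> R) (x a : R) :
  is_derive x 1 f a -> is_derive x 1 (fun y => sin (f y)) (cos (f x) * a).
Proof. by move=> df; exact: (@is_derive1_comp R sin f). Qed.

Lemma is_derive1_eq (R : realType) (f : R -> R) (x a b : R) :
  is_derive x 1 f a -> a = b -> is_derive x 1 f b.
Proof. by move=> ? <-. Qed.

(** Reads the derivative off the syntax into an existential variable, which [is_derive1_eq] then
    compares with the wanted expression. Differences are tried before sums because a difference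
    unfolds to a sum. Powers have no rule, hence [y * y] instead of [y ^+ 2] in the functions to be
    differentiated. *)
Ltac derive_fun := repeat first
  [ eapply is_derive_cst | eapply is_derive_id
  | eapply is_deriveB_fun | eapply is_deriveD_fun | eapply is_deriveN_fun
  | eapply is_deriveM_fun
  | eapply is_derive_expR_fun | eapply is_derive_cos_fun
  | eapply is_derive_sin_fun ].

Lemma le0_is_derive_nincr (R : realType) (f df : R -> R) (a : R) :
  (forall x : R, is_derive x 1 f (df x)) -> (forall x, a <= x -> df x <= 0) ->
  forall x y, a <= x -> x <= y -> f y <= f x.
Proof.
move=> dE df0 x y ax xy; apply: (@ler0_derive1_nincry R f a _ _ _ x y) => //.
- by move=> z; rewrite in_itv/= andbT => az; rewrite derive1E derive_val df0 ?ltW.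
- apply: continuous_subspaceT => z.
  by apply: differentiable_continuous; exact/derivable1_diffP.
Qed.

(** Clearing the denominator turns the claim into [g z <= 0]. Here [g' = g1], both vanish at 0, and
    [g1' y = (1 - y) e^y - 1] is nonpositive by [1 - y <= e^(-y)]. The 3 is the ratio of the Taylor
    coefficients 1/2 and 1/6, so the two sides agree up to order three. *)
Lemma expR_sub1_le (R : realType) (z : R) : 0 <= z -> z < 3 ->
  expR z - 1 - z <= z ^+ 2 / (2 * (1 - z / 3)).
Proof.
move=> z0 z3.
pose g1 (y : R) := (2 - y) * expR y - (2 + y).
pose g (y : R) := (3 - y) * expR y - (3 + 2 * y + y * y / 2).
have g1_le0 y : 0 <= y -> g1 y <= 0.
  move=> y0; have -> : 0 = g1 0 by rewrite /g1 expR0; ring.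
  apply: (@le0_is_derive_nincr R g1 (fun x => (1 - x) * expR x - 1) 0) => // x.
    by eapply is_derive1_eq; [derive_fun|rewrite /=; ring].
  move=> x0; have := expR_ge1Dx (- x); rewrite expRN => h.
  have := ler_wpM2r (expR_ge0 x) h; rewrite mulVf ?gt_eqF ?expR_gt0//; lra.
have g_le0 : g z <= 0.
  have -> : 0 = g 0 by rewrite /g expR0; ring.
  apply: (@le0_is_derive_nincr R g g1 0) => // x.
  by eapply is_derive1_eq; [derive_fun|rewrite /g1 /=; lra].
rewrite ler_pdivlMr; last by lra.
move: g_le0; rewrite /g; nra.
Qed.

(* [expR] lies below the chord through [0] and [s * b] on the left of [b] inside
   [[0, b]], and above it on the left of [0]. *)
Lemma expR_chord (R : realType) (b s y : R) : 0 < b -> y <= b ->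
  y * (expR (s * y) - 1) <= y ^+ 2 * ((expR (s * b) - 1) / b).
Proof.
move=> b0 yb.
have chord (t : R) (a c : R) : 0 <= t <= 1 ->
    expR (t * a + (1 - t) * c) <= t * expR a + (1 - t) * expR c.
  move=> /andP[t0 t1].
  have ht : Itv.spec (@Itv.num_sem R) (Itv.Real `[0%Z, 1%Z]) t.
    by rewrite /= /Itv.num_sem/= in_itv/= t0 t1 ger0_real.
  exact: (@convex_expR R (Itv.mk ht) a c).
have [y0|y0] := leP 0 y.
  rewrite expr2 -mulrA ler_wpM2l//.
  have /(chord (y / b) (s * b) 0) : 0 <= y / b <= 1.
    by rewrite divr_ge0 ?(ltW b0)//= ler_pdivrMr ?mul1r.
  rewrite mulr0 addr0 expR0 mulr1.
  have -> : y / b * (s * b) = s * y by field; rewrite gt_eqF.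
  by have -> : y * ((expR (s * b) - 1) / b) = y / b * (expR (s * b) - 1); [ring|lra].
rewrite expr2 -mulrA ler_wnM2l ?(ltW y0)//.
have by0 : 0 < b - y by lra.
have /(chord (b / (b - y)) (s * y) (s * b)) : 0 <= b / (b - y) <= 1.
  by rewrite divr_ge0 ?(ltW b0) ?(ltW by0)//= ler_pdivrMr// mul1r; lra.
have -> : b / (b - y) * (s * y) + (1 - b / (b - y)) * (s * b) = 0.
  by field; rewrite gt_eqF.
rewrite expR0 => h; have := ler_wpM2r (ltW by0) h.
rewrite mul1r mulrDl mulrAC divfK ?gt_eqF//.
have -> : (1 - b / (b - y)) * expR (s * b) * (b - y) = - y * expR (s * b).
  by field; rewrite gt_eqF.
move=> {}h; rewrite mulrA ler_pdivrMr//; lra.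
Qed.

(** [e^(-y) (1 + y^2)] has derivative [- e^(-y) (y - 1)^2]. This is the case of one Laplace factor
    in the shift bound for the test functions. *)
Lemma ler_expR_sqr1D (R : realType) (r z : R) : r <= z ->
  1 + z ^+ 2 <= expR (z - r) * (1 + r ^+ 2).
Proof.
move=> rz; pose f (y : R) := expR (- y) * (1 + y * y).
have h : f z <= f r.
  apply: (@le0_is_derive_nincr R f (fun y => - (expR (- y) * ((y - 1) * (y - 1)))) r) => // x.
    by eapply is_derive1_eq; [derive_fun|rewrite /=; ring].
  by rewrite oppr_le0 mulr_ge0 ?expR_ge0// -expr2 sqr_ge0.
have := ler_wpM2l (expR_ge0 z) h.
rewrite /f !mulrA -!expRD subrr expR0 mul1r -!expr2; lra.
Qed.

Lemma cos1_sqr_sin (R : realType) (z : R) : 1 - cos z = 2 * sin (z / 2) ^+ 2.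
Proof.
have {1}-> : z = (z / 2) *+ 2 by rewrite mulr2n; lra.
by rewrite cos_mulr2n cos2sin2 mulr2n; ring.
Qed.

Lemma normr_sin_le (R : realType) (z : R) : `|sin z| <= `|z|.
Proof.
wlog z0 : z / 0 <= z => [h|].
  have [/h//|/ltW z0] := leP 0 z.
  by rewrite -normrN -sinN -[leRHS]normrN h// oppr_ge0.
rewrite (ger0_norm z0) ler_norml; apply/andP; split.
  rewrite -subr_ge0 opprK -oppr_le0.
  have -> : 0 = - (sin 0 + 0) :> R by rewrite sin0 addr0 oppr0.
  apply: (@le0_is_derive_nincr R (fun x => - (sin x + x)) (fun x => - (cos x * 1 + 1)) 0) => // x.
    by derive_fun.
rewrite -subr_le0.
have -> : 0 = sin 0 - 0 :> R by rewrite sin0 subr0.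
apply: (@le0_is_derive_nincr R (fun x => sin x - x) (fun x => cos x * 1 - 1) 0) => // x.
by derive_fun.
Qed.

Lemma cos1_ge0 (R : realType) (z : R) : 0 <= 1 - cos z.
Proof. by rewrite subr_ge0 cos_le1. Qed.

Lemma cos1_le_sqr (R : realType) (z : R) : 1 - cos z <= z ^+ 2 / 2.
Proof.
have : `|sin (z / 2)| ^+ 2 <= `|z / 2| ^+ 2.
  by rewrite lerXn2r ?nnegrE ?normr_sin_le.
by rewrite cos1_sqr_sin !real_normK ?num_real//; lra.
Qed.

Lemma normr_cosB_le (R : realType) (x z : R) : `|cos x - cos z| <= `|x - z|.
Proof.
have h (p q : R) : `|cos (p + q) - cos (p - q)| <= `|2 * q|.
  rewrite cosD cosB (_ : _ - _ = - (2 * (sin p * sin q))); last by ring.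
  rewrite normrN !normrM ler_wpM2l ?normr_ge0//.
  by rewrite -[leRHS]mul1r ler_pM ?normr_ge0 ?sin_max ?normr_sin_le.
have := h ((x + z) / 2) ((x - z) / 2).
have -> : (x + z) / 2 + (x - z) / 2 = x by field.
have -> : (x + z) / 2 - (x - z) / 2 = z by field.
by have -> : 2 * ((x - z) / 2) = x - z by field.
Qed.

(** * Measurability, domination and differentiation under the integral *)

Lemma measurable_cos_fun d (T : measurableType d) (R : realType) (f : T -> R) :
  measurable_fun setT f -> measurable_fun setT (fun x => cos (f x)).
Proof.
move=> mf; apply: measurableT_comp => //.
by apply: continuous_measurable_fun; exact: continuous_cos.
Qed.

Lemma measurable_sin_fun d (T : measurableType d) (R : realType) (f : T -> R) :
  measurable_fun setT f -> measurable_fun setT (fun x => sin (f x)).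
Proof.
move=> mf; apply: measurableT_comp => //.
by apply: continuous_measurable_fun; exact: continuous_sin.
Qed.

Lemma measurable_expR_fun d (T : measurableType d) (R : realType) (f : T -> R) :
  measurable_fun setT f -> measurable_fun setT (fun x => expR (f x)).
Proof. by move=> mf; apply: measurableT_comp => //; exact: measurable_expR. Qed.

Ltac mfun := repeat first
  [ by [] | assumption | exact: measurable_cst
  | exact: measurable_fst | exact: measurable_snd | exact: measurable_id
  | apply: measurable_funX
  | apply: measurable_funM | apply: measurable_funB
  | apply: measurable_funD | apply: (@measurableT_comp _ _ _ _ _ _ -%R)
  | apply: measurable_cos_fun | apply: measurable_sin_fun
  | apply: measurable_expR_fun
  | apply: (@measurableT_comp _ _ _ _ _ _ (@Num.norm _ _)) ].

Lemma integrable_dominated d (T : measurableType d) (R : realType)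
    (mu : {measure set T -> \bar R}) (f g : T -> R) :
  measurable_fun setT f -> mu.-integrable setT (EFin \o g) ->
  (forall x, `|f x| <= g x) -> mu.-integrable setT (EFin \o f).
Proof.
move=> mf ig fg; apply: (le_integrable _ _ _ ig) => //.
  exact/measurable_EFinP.
by move=> x _ /=; rewrite lee_fin (le_trans (fg x))// ler_norm.
Qed.

Lemma integrable_bounded d (T : measurableType d) (R : realType)
    (P : probability T R) (f : T -> R) (M : R) :
  measurable_fun setT f -> (forall x, `|f x| <= M) ->
  P.-integrable setT (EFin \o f).
Proof.
move=> mf fM; apply: (integrable_dominated mf _ fM).
exact: finite_measure_integrable_cst.
Qed.

(** Domination is asked only within distance 1 of [u], which admits bounds such as [(|u| + 1) y^2]
    that grow with the parameter. *)
Lemma is_derive_Rintegral d (T : measurableType d) (R : realType)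
    (mu : {measure set T -> \bar R}) (f df : R -> T -> R) (G : T -> R) (u : R) :
  (forall v, mu.-integrable setT (EFin \o f v)) ->
  (forall (v : R) x, is_derive v 1 (f ^~ x) (df v x)) ->
  mu.-integrable setT (EFin \o G) ->
  (forall v x, `|v - u| < 1 -> `|df v x| <= G x) ->
  is_derive u 1 (fun v => \int[mu]_x f v x) (\int[mu]_x df u x).
Proof.
move=> intf dfE intG dfG.
have p1E v x : partial1of2 f v x = df v x.
  by rewrite partial1of2E derive_val.
have uI : `](u - 1), (u + 1)[%classic u by rewrite /= in_itv/=; lra.
have G0 y : 0 <= G y by rewrite (le_trans (normr_ge0 (df u y)))// dfG// subrr normr0.
have df' (v : R) x : derivable (f ^~ x) v 1 by [].
have Gub (v : R) x : `](u - 1), (u + 1)[%classic v -> [set: T] x -> `|partial1of2 f v x| <= G x.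
  rewrite /= in_itv/= => /andP[v1 v2] _; rewrite p1E dfG//.
  by rewrite ltr_norml; lra.
have <- : derive1 (fun v => \int[mu]_x f v x) u = \int[mu]_x df u x.
  rewrite (differentiation_under_integral measurableT uI (fun v _ => intf v)
           (fun v x _ _ => df' v x) G0 intG Gub).
  by apply: eq_Rintegral => x _; rewrite /= p1E.
rewrite derive1E; apply: DeriveDef => //.
exact: (derivable_under_integral measurableT uI (fun v _ => intf v)
         (fun v x _ _ => df' v x) G0 intG Gub).
Qed.

(** * The Stein identity of an infinitely divisible law *)

Lemma Rintegral_prob_cst d (T : measurableType d) (R : realType)
  (P : probability T R) (c : R) : \int[P]_x c = c.
Proof. by rewrite Rintegral_cst//= probability_setT mulr1. Qed.

(** Fatou's lemma with upper bounds [w n] that vary with [n]. It serves twice: for the second moment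
    of the Lévy measure and for the passage from test functions to exponentials. *)
Lemma fatou_le d (T : measurableType d) (R : realType)
    (mu : {measure set T -> \bar R}) (f_ : nat -> T -> R) (f : T -> R)
    (w : nat -> R) (L : R) :
  (forall n, measurable_fun setT (f_ n)) -> (forall n x, 0 <= f_ n x) ->
  (forall x, f_ n x @[n --> \oo] --> f x) ->
  (forall n, (\int[mu]_x (f_ n x)%:E <= (w n)%:E)%E) ->
  w n @[n --> \oo] --> L ->
  (\int[mu]_x (f x)%:E <= L%:E)%E.
Proof.
move=> mf f0 ff fw wL.
have -> : (\int[mu]_x (f x)%:E = \int[mu]_x limn_einf (fun n => (f_ n x)%:E))%E.
  apply: eq_integral => x _.
  have : (f_ n x)%:E @[n --> \oo] --> (f x)%:E by apply/cvg_EFin; [exact: nearW|exact: ff].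
  by move=> /cvg_limn_einf_sup[].
apply: (@le_trans _ _ (limn_einf (fun n => \int[mu]_x (f_ n x)%:E)%E)).
  apply: (@fatou _ _ _ mu setT measurableT (fun n x => (f_ n x)%:E)).
    by move=> n; exact/measurable_EFinP.
  by move=> n x _; rewrite lee_fin.
have wL' : (w n)%:E @[n --> \oo] --> L%:E by apply/cvg_EFin; [exact: nearW|exact: wL].
rewrite limn_einf_lim -(cvg_lim _ wL')//; apply: lee_lim.
- exact: is_cvg_einfs.
- by apply/cvg_ex; exists L%:E.
- apply: nearW => n; apply: le_trans (fw n).
  by apply: ereal_inf_lbound; exists n => /=.
Qed.

(** The quotient is the difference quotient of [v -> sin (v z)] at 0, taken along the sequence
    [u]. *)
Lemma sinM_div_cvg (R : realType) (z : R) (u : nat -> R) :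
  (forall n, u n != 0) -> u n @[n --> \oo] --> 0 ->
  sin (u n * z) / u n @[n --> \oo] --> z.
Proof.
move=> u0 uc.
have d0 : is_derive (0 : R) (1:R) (fun v => sin (v * z)) z.
  eapply is_derive1_eq; first by derive_fun.
  by rewrite /= mul0r cos0; ring.
have /cvg_ex[l] := @ex_derive _ _ _ _ _ _ _ d0.
move=> /[dup] /cvg_lim hl.
have {}hl : l = z by rewrite -hl//; exact: derive_val.
rewrite {l}hl => /cvgr_dnbhsP/(_ u (conj u0 uc)).
under eq_fun do rewrite /= addr0 mul0r sin0 subr0 /GRing.scale/= mulr1 mulrC.
by [].
Qed.

Lemma is_derive1_unique (R : realType) (f : R -> R) (x a b : R) :
  is_derive x 1 f a -> is_derive x 1 f b -> a = b.
Proof. by case=> _ <- [_ <-]. Qed.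

Lemma normr_sinB_le_sqr (R : realType) (z : R) : `|sin z - z| <= z ^+ 2.
Proof.
wlog z0 : z / 0 <= z => [h|].
  have [/h//|/ltW z0] := leP 0 z.
  have := h (- z); rewrite oppr_ge0 sinN sqrrN -opprD normrN; exact.
have := normr_sin_le z; rewrite (ger0_norm z0) ler_norml => /andP[_ sz].
rewrite distrC ger0_norm ?subr_ge0// -subr_le0.
have -> : 0 = 0 - sin 0 - 0 ^+ 2 :> R by rewrite sin0 expr2; ring.
rewrite !expr2.
apply: (@le0_is_derive_nincr R (fun x => x - sin x - x * x)
  (fun x => 1 - cos x * 1 - (1 * x + x * 1)) 0) => // x.
  by derive_fun.
move=> x0; have := normr_cosB_le x 0; rewrite cos0 subr0 (ger0_norm x0).
by rewrite ler_norml => /andP[]; lra.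
Qed.

Section levy_drift.
Context (R : realType) d2 (T2 : measurableType d2) (nu : {measure set T2 -> \bar R}).
Variable y : T2 -> R.
Hypotheses (my : measurable_fun setT y)
  (iy2 : nu.-integrable setT (EFin \o (fun x => y x ^+ 2))).

(** Together with the Gaussian variance [a] these give the derivative of the Lévy exponent of a
    centred law: [psi'(q) = - (q a + alpha(q)) + i beta(q)]. *)
Definition levy_alpha q := \int[nu]_x (y x * sin (q * y x)).
Definition levy_beta q := \int[nu]_x (y x * (cos (q * y x) - 1)).

Lemma integrable_levy_alpha q :
  nu.-integrable setT (EFin \o (fun x => y x * sin (q * y x))).
Proof.
apply: (@integrable_dominated _ _ _ _ _ (fun x => `|q| * y x ^+ 2)); first by mfun.
  rewrite /comp; under eq_fun do rewrite EFinM.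
  exact: integrableZl.
move=> x; rewrite normrM -(real_normK (num_real (y x))).
have := normr_sin_le (q * y x); rewrite normrM.
by have := normr_ge0 (y x); nra.
Qed.

Lemma integrable_levy_beta q :
  nu.-integrable setT (EFin \o (fun x => y x * (cos (q * y x) - 1))).
Proof.
apply: (@integrable_dominated _ _ _ _ _ (fun x => `|q| * y x ^+ 2)); first by mfun.
  rewrite /comp; under eq_fun do rewrite EFinM.
  exact: integrableZl.
move=> x; rewrite normrM -(real_normK (num_real (y x))).
have := normr_cosB_le (q * y x) 0; rewrite cos0 subr0 normrM.
by have := normr_ge0 (y x); nra.
Qed.

End levy_drift.

Section levy_identity.
Context (R : realType) d1 (T1 : measurableType d1) (P : probability T1 R)
  d2 (T2 : measurableType d2) (nu : {measure set T2 -> \bar R}).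
Variables (Y : T1 -> R) (y : T2 -> R) (a g : R) (D : set T2).
Hypotheses (mY : measurable_fun setT Y) (my : measurable_fun setT y)
  (mD : measurable D)
  (iY2 : P.-integrable setT (EFin \o (fun x => Y x ^+ 2)))
  (EY0 : \int[P]_x Y x = 0)
  (nuD : (nu (~` D) < +oo)%E)
  (iyD : (\int[nu]_(x in D) (y x ^+ 2)%:E < +oo)%E).

(** Real and imaginary parts of the exponent along a line. The truncation set [D] is a separate
    variable because it will be the unit ball of the whole space, and membership in it cannot be
    recovered from the projection [y]. *)
Definition levy_re u := - (u ^+ 2 * a) / 2 + \int[nu]_x (cos (u * y x) - 1).
Definition levy_im u :=
  u * g + \int[nu]_x (sin (u * y x) - u * y x * \1_D x).

Hypotheses
  (EcosY : forall u, \int[P]_x cos (u * Y x) = expR (levy_re u) * cos (levy_im u))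
  (EsinY : forall u, \int[P]_x sin (u * Y x) = expR (levy_re u) * sin (levy_im u)).

Let V := \int[P]_x (Y x ^+ 2).

Let dom x := y x ^+ 2 * \1_D x + \1_(~` D) x.

Let idom : nu.-integrable setT (EFin \o dom).
Proof.
rewrite /dom /comp; under eq_fun do rewrite EFinD.
apply: integrableD => //.
  apply/integrableP; split; first by apply/measurable_EFinP; mfun.
  rewrite (eq_integral ((fun x => (y x ^+ 2)%:E) \_ D)); first by rewrite -integral_mkcond.
  move=> x _ /=; rewrite patchE ?indicE.
  by case: (x \in D); rewrite /= ?mulr1 ?mulr0 ?normr0// ger0_norm ?sqr_ge0.
apply/integrableP; split.
  by apply/measurable_EFinP; apply: measurable_indic; exact: measurableC.
rewrite (eq_integral (fun x => (\1_(~` D) x)%:E)); last first.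
  by move=> x _ /=; rewrite ger0_norm.
by rewrite integral_indic ?setIT//; exact: measurableC.
Qed.

Let domE x : dom x = if x \in D then y x ^+ 2 else 1.
Proof. by rewrite /dom !indicE in_setC; case: (x \in D) => /=; ring. Qed.

Let icos u : nu.-integrable setT (EFin \o (fun x => cos (u * y x) - 1)).
Proof.
apply: (@integrable_dominated _ _ _ _ _ (fun x => (u ^+ 2 / 2 + 2) * dom x)).
- by mfun.
- rewrite /comp; under eq_fun do rewrite EFinM.
  exact: integrableZl.
move=> x; rewrite distrC ger0_norm ?cos1_ge0// domE.
have u2 : 0 <= u ^+ 2 / 2 by rewrite divr_ge0 ?sqr_ge0.
have := cos1_le_sqr (u * y x); have := cos_geN1 (u * y x).
case: ifP => _; last by lra.
by rewrite exprMn; have := sqr_ge0 (y x); nra.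
Qed.

Let iY : P.-integrable setT (EFin \o Y).
Proof.
apply: (@integrable_dominated _ _ _ _ _ (fun x => 1 + Y x ^+ 2)) => //.
  rewrite /comp; under eq_fun do rewrite EFinD.
  apply: integrableD => //; exact: finite_measure_integrable_cst.
move=> x; rewrite -[X in _ <= _ + X]real_normK ?num_real//.
by have := sqr_ge0 (`|Y x| - 1); have := normr_ge0 (Y x); nra.
Qed.

Let V0 : 0 <= V. Proof. by apply: Rintegral_ge0 => x _; exact: sqr_ge0. Qed.

Let Ecos_ge u : 1 - u ^+ 2 * V / 2 <= \int[P]_x cos (u * Y x).
Proof.
have iq : P.-integrable setT (EFin \o (fun x => 1 - u ^+ 2 / 2 * Y x ^+ 2)).
  rewrite /comp; under eq_fun do rewrite EFinB EFinM.
  apply: integrableB => //; first exact: finite_measure_integrable_cst.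
  exact: integrableZl.
have -> : 1 - u ^+ 2 * V / 2 = \int[P]_x (1 - u ^+ 2 / 2 * Y x ^+ 2).
  rewrite RintegralB//; last 2 first.
    exact: finite_measure_integrable_cst.
    rewrite /comp; under eq_fun do rewrite EFinM.
    exact: integrableZl.
  by rewrite Rintegral_prob_cst RintegralZl//= -/V; ring.
apply: le_Rintegral => //.
  by apply: (@integrable_bounded _ _ _ _ _ 1); [mfun|move=> x; exact: cos_max].
move=> x _; have := cos1_le_sqr (u * Y x); rewrite exprMn; lra.
Qed.

(** A second order bound obtained without logarithms. With [v = u^2 V], the squared modulus
    [e^(2 re)] of the characteristic function is at least [(1 - v/2)^2], while
    [1 - 2 re <= e^(-2 re)]. Multiplying, [(1 - 2 re) (1 - v/2)^2 <= 1], and [1 + v (1 + 2 v)]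
    dominates [(1 - v/2)^-2] for [v <= 1/2]. The error [2 v^2] disappears after division by [u^2] as
    [u] tends to 0. *)
Let re_ge u : u ^+ 2 * V <= 1 / 2 ->
  - levy_re u * 2 <= u ^+ 2 * V * (1 + 2 * (u ^+ 2 * V)).
Proof.
set v := u ^+ 2 * V => v2.
have v0 : 0 <= v by rewrite mulr_ge0 ?sqr_ge0.
have h : (1 - v / 2) ^+ 2 <= expR (levy_re u * 2).
  have -> : expR (levy_re u * 2) =
      (\int[P]_x cos (u * Y x)) ^+ 2 + (\int[P]_x sin (u * Y x)) ^+ 2.
    rewrite EcosY EsinY !exprMn -mulrDr addrC cos2sin2.
    by rewrite addrC subrK mulr1 expr2 -expRD; congr expR; ring.
  apply: le_trans (_ : (\int[P]_x cos (u * Y x)) ^+ 2 <= _).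
    rewrite lerXn2r ?nnegrE//; last by rewrite /v; exact: Ecos_ge.
    by lra.
    by apply: le_trans (Ecos_ge u); rewrite -/v; lra.
  by rewrite lerDl sqr_ge0.
have e1 := expR_ge1Dx (- (levy_re u * 2)).
have e2 : expR (- (levy_re u * 2)) * expR (levy_re u * 2) = 1.
  by rewrite -expRD addNr expR0.
have e3 : (1 + - (levy_re u * 2)) * (1 - v / 2) ^+ 2 <= 1.
  apply: le_trans (_ : expR (- (levy_re u * 2)) * (1 - v / 2) ^+ 2 <= _).
    by rewrite ler_wpM2r// sqr_ge0.
  by rewrite -[leRHS]e2 ler_wpM2l// expR_ge0.
have e4 : 1 <= (1 - v / 2) ^+ 2 * (1 + v * (1 + 2 * v)) by nra.
have e5 : 0 < (1 - v / 2) ^+ 2 by rewrite exprn_gt0//; lra.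
rewrite -(ler_pM2r e5); lra.
Qed.

(** The functions [2 (1 - cos (u y)) / u^2] tend to [y^2] as [u -> 0], and by [re_ge] their
    [nu]-integrals are at most [V - a + 2 V^2 u^2]; Fatou's lemma concludes. *)
Lemma levy_second_moment_le :
  (\int[nu]_x (y x ^+ 2)%:E <= (V - a)%:E)%E.
Proof.
(* Adding [K >= 2 V] to the denominators keeps [u n ^+ 2 * V <= 1 / 2] from the first term on, as
   [re_ge] demands. *)
have [K K0 KV] : exists2 K : R, 0 < K & 2 * V <= K.
  by exists (2 * V + 1); have := V0; lra.
pose u (n : nat) := (n%:R + 1 + K)^-1.
have u0 n : 0 < u n by rewrite invr_gt0; have := ler0n R n; lra.
have uK n : u n ^+ 2 * V <= 1 / 2.
  have n0 := ler0n R n.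
  have e : u n * (n%:R + 1 + K) = 1 by rewrite mulVf// gt_eqF//; lra.
  have := u0 n; nra.
have uc : u n @[n --> \oo] --> 0.
  apply: (@squeeze_cvgr _ _ _ _ (cst 0) harmonic); last 2 first.
    exact: cvg_cst.
    exact: cvg_harmonic.
  apply: nearW => n; rewrite (ltW (u0 n))/= /u /harmonic/= -natr1.
  have n0 := ler0n R n; rewrite lef_pV2 ?posrE; lra.
pose f n x := 2 / u n ^+ 2 * (1 - cos (u n * y x)).
apply: (@fatou_le _ _ _ nu f _ (fun n => V - a + 2 * V * V * (u n * u n))).
- by move=> n; rewrite /f; mfun.
- move=> n x; rewrite mulr_ge0 ?cos1_ge0// divr_ge0// sqr_ge0//.
- move=> x; rewrite [X in X @ _ --> _](_ : _ = fun n =>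
      (sin (u n / 2 * y x) / (u n / 2)) ^+ 2); last first.
    apply/funext => n; rewrite /f cos1_sqr_sin.
    rewrite (_ : u n * y x / 2 = u n / 2 * y x); last by ring.
    by field; rewrite gt_eqF.
  rewrite [X in _ --> X]expr2 /=; under eq_fun do rewrite expr2.
  have h : sin (u n / 2 * y x) / (u n / 2) @[n --> \oo] --> y x.
    apply: sinM_div_cvg => [n|]; first by rewrite gt_eqF// divr_gt0.
    by rewrite -[X in _ --> X](mul0r 2^-1); apply: cvgMr_tmp.
  exact: cvgM.
- move=> n; rewrite /f.
  have un2 : 0 < u n ^+ 2 by rewrite exprn_gt0.
  have iq : nu.-integrable setT (EFin \o (fun x => 1 - cos (u n * y x))).
    have := integrableN (icos (u n)).
    by apply: eq_integrable => // x _ /=; rewrite -?EFinN ?opprB.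
  under eq_integral do rewrite EFinM.
  rewrite integralZl//.
  have -> : (\int[nu]_x (1 - cos (u n * y x))%:E)%E =
            (\int[nu]_x (1 - cos (u n * y x)))%:E.
    by rewrite fineK//; exact: integrable_fin_num.
  rewrite -EFinM lee_fin.
  have := re_ge (uK n); rewrite /levy_re.
  have -> : \int[nu]_x (cos (u n * y x) - 1) = - \int[nu]_x (1 - cos (u n * y x)).
    rewrite -[RHS]mulN1r -RintegralZl//; apply: eq_Rintegral => x _; ring.
  move=> h; rewrite mulrAC ler_pdivrMr//; nra.
- rewrite -[X in _ --> X]addr0; apply: cvgD; first exact: cvg_cst.
  rewrite -(mulr0 (2 * V * V)); apply: cvgMl_tmp.
  by rewrite -(mulr0 0); exact: cvgM.
Qed.

Lemma levy_integrable_sqr : nu.-integrable setT (EFin \o (fun x => y x ^+ 2)).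
Proof.
apply/integrableP; split; first by apply/measurable_EFinP; mfun.
apply: le_lt_trans (ltry (V - a)); apply: le_trans levy_second_moment_le.
rewrite le_eqVlt; apply/orP; left; apply/eqP; apply: eq_integral => x _ /=.
by rewrite ger0_norm ?sqr_ge0.
Qed.


Let iy2 := levy_integrable_sqr.

Let idom2 : nu.-integrable setT (EFin \o (fun x => y x ^+ 2 + \1_(~` D) x)).
Proof.
have i1 : nu.-integrable setT (EFin \o (fun x => y x ^+ 2 + dom x)).
  rewrite /comp; under eq_fun do rewrite EFinD.
  exact: integrableD.
apply: (integrable_dominated _ i1) => [|x].
  by apply: measurable_funD; [mfun|apply: measurable_indic; exact: measurableC].
rewrite domE !indicE in_setC ger0_norm ?addr_ge0 ?sqr_ge0//.
by case: (x \in D) => //=; rewrite lerD2l ?sqr_ge0.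
Qed.

Let normr_near (u v : R) : `|v - u| < 1 -> `|v| <= `|u| + 1.
Proof.
move=> vu; have := ler_normD u (v - u); rewrite addrC subrK.
lra.
Qed.

Lemma is_derive_levy_re (u : R) :
  is_derive u 1 levy_re (- (u * a) - levy_alpha nu y u).
Proof.
have h : is_derive u 1 (fun v => \int[nu]_x (cos (v * y x) - 1))
    (\int[nu]_x (- (y x * sin (u * y x)))).
  apply: (@is_derive_Rintegral _ _ _ _ (fun v x => cos (v * y x) - 1)
    (fun v x => - (y x * sin (v * y x))) (fun x => (`|u| + 1) * y x ^+ 2)) => //.
  - move=> v x; eapply is_derive1_eq; first by derive_fun.
    by rewrite /=; ring.
  - rewrite /comp; under eq_fun do rewrite EFinM.
    exact: integrableZl.
  - move=> v x /normr_near vu; rewrite normrN normrM -(real_normK (num_real (y x))).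
    have := normr_sin_le (v * y x); rewrite normrM.
    have := normr_ge0 (y x); set t := `|y x| => t0 h.
    have := ler_wpM2r t0 vu; nra.
rewrite /levy_re; eapply is_derive1_eq.
  eapply is_deriveD_fun; [|exact: h].
  rewrite (_ : (fun v => _) = (fun v => - (v * v * a) / 2)); last first.
    by apply/funext => v; rewrite expr2.
  by derive_fun.
rewrite /=; have -> : \int[nu]_x (- (y x * sin (u * y x))) = - levy_alpha nu y u.
  rewrite /levy_alpha -[RHS]mulN1r -RintegralZl//; last exact: (integrable_levy_alpha my iy2).
  by apply: eq_Rintegral => x _; rewrite mulN1r.
lra.
Qed.

(** Outside [D] the derivative [y cos (u y)] of the integrand is unbounded, and finiteness of [nu]
    there does not suffice; it is dominated through [|y| <= 1 + y^2] and the second moment just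
    obtained. *)
Lemma is_derive_levy_im (u : R) : is_derive u 1 levy_im
  (g + \int[nu]_x (y x * cos (u * y x) - y x * \1_D x)).
Proof.
have h : is_derive u 1 (fun v => \int[nu]_x (sin (v * y x) - v * y x * \1_D x))
    (\int[nu]_x (y x * cos (u * y x) - y x * \1_D x)).
  apply: (@is_derive_Rintegral _ _ _ _ (fun v x => sin (v * y x) - v * y x * \1_D x)
    (fun v x => y x * cos (v * y x) - y x * \1_D x)
    (fun x => (`|u| + 1) * (y x ^+ 2 + \1_(~` D) x))) => //.
  - move=> v; apply: (@integrable_dominated _ _ _ _ _
      (fun x => (v ^+ 2 + 1) * (y x ^+ 2 + \1_(~` D) x))); first by mfun.
      rewrite /comp; under eq_fun do rewrite EFinM.
      exact: integrableZl.
    move=> x; rewrite !indicE in_setC; case: (x \in D) => /=.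
      have := normr_sinB_le_sqr (v * y x); rewrite mulr1 addr0 exprMn.
      by have := sqr_ge0 (y x); nra.
    rewrite mulr0 subr0; have := sin_max (v * y x).
    by have := sqr_ge0 (y x); have := sqr_ge0 v; nra.
  - move=> v x; eapply is_derive1_eq; first by derive_fun.
    by rewrite /=; ring.
  - rewrite /comp; under eq_fun do rewrite EFinM.
    exact: integrableZl.
  - move=> v x /normr_near vu.
    have y0 := normr_ge0 (y x); rewrite -(real_normK (num_real (y x))).
    rewrite !indicE in_setC; case: (x \in D) => /=.
      rewrite -mulrBr normrM addr0.
      have := normr_cosB_le (v * y x) 0; rewrite cos0 subr0 normrM => h.
      have := ler_wpM2r y0 vu; nra.
    rewrite mulr0 subr0 normrM.
    have := cos_max (v * y x); have := normr_ge0 u.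
    have := normr_ge0 (cos (v * y x)).
    by have := sqr_ge0 (`|y x| - 1); nra.
rewrite /levy_im; eapply is_derive1_eq.
  eapply is_deriveD_fun; [|exact: h].
  by derive_fun.
by rewrite /=; ring.
Qed.

Let isinYY u : P.-integrable setT (EFin \o (fun x => Y x * sin (u * Y x))).
Proof.
apply: (@integrable_dominated _ _ _ _ _ (fun x => `|Y x|)); first by mfun.
  exact: integrable_norm.
by move=> x; rewrite normrM -[leRHS]mulr1 ler_wpM2l ?sin_max.
Qed.

Let icosYY u : P.-integrable setT (EFin \o (fun x => Y x * cos (u * Y x))).
Proof.
apply: (@integrable_dominated _ _ _ _ _ (fun x => `|Y x|)); first by mfun.
  exact: integrable_norm.
by move=> x; rewrite normrM -[leRHS]mulr1 ler_wpM2l ?cos_max.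
Qed.

Let icosY u : P.-integrable setT (EFin \o (fun x => cos (u * Y x))).
Proof. by apply: (@integrable_bounded _ _ _ _ _ 1); [mfun|move=> x; exact: cos_max]. Qed.

Let isinY u : P.-integrable setT (EFin \o (fun x => sin (u * Y x))).
Proof. by apply: (@integrable_bounded _ _ _ _ _ 1); [mfun|move=> x; exact: sin_max]. Qed.

Let dcosY (u : R) : is_derive u 1 (fun v => \int[P]_x cos (v * Y x))
  (- \int[P]_x (Y x * sin (u * Y x))).
Proof.
have -> : - (\int[P]_x (Y x * sin (u * Y x))) = \int[P]_x (- (Y x * sin (u * Y x))).
  rewrite -[LHS]mulN1r -RintegralZl//.
  by apply: eq_Rintegral => x _; rewrite mulN1r.
apply: (@is_derive_Rintegral _ _ _ _ (fun v x => cos (v * Y x))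
  (fun v x => - (Y x * sin (v * Y x))) (fun x => `|Y x|)) => //.
- move=> v x; eapply is_derive1_eq; first by derive_fun.
  by rewrite /=; ring.
- exact: integrable_norm.
- by move=> v x _; rewrite normrN normrM -[leRHS]mulr1 ler_wpM2l ?sin_max.
Qed.

Let dsinY (u : R) : is_derive u 1 (fun v => \int[P]_x sin (v * Y x))
  (\int[P]_x (Y x * cos (u * Y x))).
Proof.
apply: (@is_derive_Rintegral _ _ _ _ (fun v x => sin (v * Y x))
  (fun v x => Y x * cos (v * Y x)) (fun x => `|Y x|)) => //.
- move=> v x; eapply is_derive1_eq; first by derive_fun.
  by rewrite /=; ring.
- exact: integrable_norm.
- by move=> v x _; rewrite normrM -[leRHS]mulr1 ler_wpM2l ?cos_max.
Qed.

(** Two computations of the derivative of [E cos (u Y)]: under the integral, and through the product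
    [e^re cos im]. The slope [d] of [levy_im] is left open because the identities are used first
    with the raw slope, to determine the drift, and then with [levy_beta]. *)
Let EYsin (u d : R) : is_derive u 1 levy_im d ->
  - (\int[P]_x (Y x * sin (u * Y x))) =
    (- (u * a) - levy_alpha nu y u) * \int[P]_x cos (u * Y x)
    - d * \int[P]_x sin (u * Y x).
Proof.
move=> dim; apply: is_derive1_unique (dcosY u) _.
under eq_fun do rewrite EcosY.
rewrite EcosY EsinY; eapply is_derive1_eq.
  by eapply is_deriveM_fun; [eapply is_derive_expR_fun; exact: is_derive_levy_re
    |eapply is_derive_cos_fun; exact: dim].
by rewrite /=; ring.
Qed.

Let EYcos (u d : R) : is_derive u 1 levy_im d ->
  \int[P]_x (Y x * cos (u * Y x)) =
    (- (u * a) - levy_alpha nu y u) * \int[P]_x sin (u * Y x)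
    + d * \int[P]_x cos (u * Y x).
Proof.
move=> dim; apply: is_derive1_unique (dsinY u) _.
under eq_fun do rewrite EsinY.
rewrite EcosY EsinY; eapply is_derive1_eq.
  by eapply is_deriveM_fun; [eapply is_derive_expR_fun; exact: is_derive_levy_re
    |eapply is_derive_sin_fun; exact: dim].
by rewrite /=; ring.
Qed.

(* [Y] being centred, the derivative of [levy_im] vanishes at [0]; this removes
   both the drift [g] and the truncation at [D]. *)
Let is_derive_levy_im_beta (u : R) : is_derive u 1 levy_im (levy_beta nu y u).
Proof.
have i u' : nu.-integrable setT
    (EFin \o (fun x => y x * cos (u' * y x) - y x * \1_D x)).
  apply: (@integrable_dominated _ _ _ _ _
      (fun x => (`|u'| + 1) * (y x ^+ 2 + \1_(~` D) x))); first by mfun.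
    rewrite /comp; under eq_fun do rewrite EFinM.
    exact: integrableZl.
  move=> x; have y0 := normr_ge0 (y x); rewrite -(real_normK (num_real (y x))).
  rewrite !indicE in_setC; case: (x \in D) => /=.
    rewrite -mulrBr normrM addr0.
    by have := normr_cosB_le (u' * y x) 0; rewrite cos0 subr0 normrM; nra.
  rewrite mulr0 subr0 normrM.
  have := cos_max (u' * y x); have := normr_ge0 u'.
  have := normr_ge0 (cos (u' * y x)).
  by have := sqr_ge0 (`|y x| - 1); nra.
have := EYcos (is_derive_levy_im 0).
have -> : \int[P]_x (Y x * cos (0 * Y x)) = 0.
  by rewrite -[RHS]EY0; apply: eq_Rintegral => x _; rewrite mul0r cos0 mulr1.
have -> : \int[P]_x sin (0 * Y x) = 0.
  by rewrite -[RHS](Rintegral_prob_cst P 0); apply: eq_Rintegral => x _; rewrite mul0r sin0.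
have -> : \int[P]_x cos (0 * Y x) = 1.
  by rewrite -[RHS](Rintegral_prob_cst P 1); apply: eq_Rintegral => x _; rewrite mul0r cos0.
rewrite mulr0 add0r mulr1 => g0.
eapply is_derive1_eq; first exact: is_derive_levy_im.
rewrite -[LHS]subr0 g0 opprD addrACA subrr add0r -RintegralB//.
apply: eq_Rintegral => x _; rewrite mul0r cos0; ring.
Qed.

(** Real part of [E[Y e^(i(p + q Y))] = - i psi'(q) E[e^(i(p + q Y))]]. The free phase [p] is needed
    because [p = U] and [q = - h U] will vary together. *)
Lemma levy_stein p q :
  \int[P]_x (Y x * cos (p + q * Y x)) =
  - (q * a + levy_alpha nu y q) * \int[P]_x sin (p + q * Y x)
  + levy_beta nu y q * \int[P]_x cos (p + q * Y x).
Proof.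
have h1 := EYsin (is_derive_levy_im_beta q).
have h2 := EYcos (is_derive_levy_im_beta q).
have iZ c (f : T1 -> R) : P.-integrable setT (EFin \o f) ->
    P.-integrable setT (EFin \o (fun x => c * f x)).
  move=> fi; rewrite /comp; under eq_fun do rewrite EFinM.
  exact: integrableZl.
have -> : \int[P]_x sin (p + q * Y x) =
    sin p * \int[P]_x cos (q * Y x) + cos p * \int[P]_x sin (q * Y x).
  rewrite -!RintegralZl// -RintegralD//; [|exact: iZ..].
  by apply: eq_Rintegral => x _; rewrite sinD.
have -> : \int[P]_x cos (p + q * Y x) =
    cos p * \int[P]_x cos (q * Y x) - sin p * \int[P]_x sin (q * Y x).
  rewrite -!RintegralZl// -RintegralB//; [|exact: iZ..].
  by apply: eq_Rintegral => x _; rewrite cosD.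
have -> : \int[P]_x (Y x * cos (p + q * Y x)) =
    cos p * \int[P]_x (Y x * cos (q * Y x)) - sin p * \int[P]_x (Y x * sin (q * Y x)).
  rewrite -!RintegralZl// -RintegralB//; [|exact: iZ..].
  by apply: eq_Rintegral => x _; rewrite cosD; ring.
rewrite h2 -[X in _ - _ * X]opprK h1; ring.
Qed.

End levy_identity.

(** * Laplace test functions *)

Definition exp_law (R : realType) : probability (measurableTypeR R) R.
Proof. by refine (exponential_prob (1 : R) : probability _ _); exact: ltr01. Defined.

Lemma exp_law_dom (R : realType) : exp_law R `<< @lebesgue_measure R.
Proof.
apply/null_content_dominatesP => A mA A0; apply: null_set_integral => //.
apply/measurable_EFinP/measurable_funTS.
exact: measurable_exponential_pdf.
Qed.

Lemma ge0_integral_exp_law (R : realType) (f : R -> R) :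
  measurable_fun setT f -> (forall x, 0 <= f x) ->
  (\int[exp_law R]_x (f x)%:E =
   \int[lebesgue_measure]_(x in `[0%R, +oo[) (f x * expR (- x))%:E)%E.
Proof.
move=> mf f0; have dom := @exp_law_dom R.
have mpdf : measurable_fun setT (fun x : R => (exponential_pdf 1 x)%:E).
  by apply/measurable_EFinP; exact: measurable_exponential_pdf.
have f0' x : (0 <= (f x)%:E)%E by rewrite lee_fin.
have mf' : measurable_fun setT (fun x => (f x)%:E) by exact/measurable_EFinP.
rewrite -(Radon_Nikodym_SigmaFinite.change_of_variables dom f0' measurableT mf').
transitivity (\int[lebesgue_measure]_x ((f x)%:E * (exponential_pdf 1 x)%:E))%E.
  apply: ae_eq_integral => //.
  - apply: emeasurable_funM; first exact/measurable_EFinP.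
    exact: measurable_int (Radon_Nikodym_SigmaFinite.f_integrable dom).
  - by apply: emeasurable_funM => //; exact/measurable_EFinP.
  - apply: ae_eqe_mul2l; apply: integral_ae_eq => //.
      exact: Radon_Nikodym_SigmaFinite.f_integrable.
    by move=> E _ mE; rewrite -Radon_Nikodym_SigmaFinite.f_integral.
rewrite [RHS]integral_mkcond; apply: eq_integral => x _.
rewrite /exponential_pdf !patchE; case: ifP => _; last by rewrite mule0.
by rewrite -EFinM mul1r mulN1r.
Qed.

Lemma cvg_inv_pinfty (R : realType) (c : R) : c / x @[x --> +oo%R] --> 0.
Proof.
apply/cvgrPdist_le => e e0; near=> x.
have x0 : 0 < x by near: x; exact: nbhs_pinfty_gt.
rewrite sub0r normrN normrM normfV (gtr0_norm x0) ler_pdivrMr// -ler_pdivrMl//.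
Unshelve. all: by end_near. Qed.

(** [G] is an antiderivative that vanishes at infinity. The integrand [f] is nonnegative on the
    whole line, whereas the smooth [g] has to agree with it only on the half-line that carries the
    law. *)
Lemma integral_exp_law_FTC (R : realType) (f g G : R -> R) (C : R) :
  measurable_fun setT f -> (forall x, 0 <= f x) ->
  (forall x, 0 <= x -> f x = g x) -> continuous g ->
  (forall x : R, is_derive x 1 G (g x * expR (- x))) ->
  (forall x, 0 <= x -> `|G x| <= C * (1 + x) * expR (- x)) ->
  (\int[exp_law R]_x (f x)%:E = (- G 0)%:E)%E.
Proof.
move=> mf f0 fg cg dG GC; rewrite ge0_integral_exp_law//.
transitivity (\int[lebesgue_measure]_(x in `[0%R, +oo[) (g x * expR (- x))%:E)%E.
  by apply: eq_integral => x; rewrite inE/= in_itv/= andbT => x0; rewrite fg.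
have cG : continuous G.
  by move=> x; apply: differentiable_continuous; exact/derivable1_diffP.
have C0 : 0 <= C.
  have := GC 0 (lexx 0); rewrite oppr0 expR0 addr0 !mulr1.
  exact: le_trans.
rewrite (@ge0_continuous_FTC2y R _ G 0 0).
- by rewrite -EFinB sub0r.
- by move=> x x0; rewrite -fg// mulr_ge0// expR_ge0.
- apply: continuous_subspaceT => x; apply: cvgM; first exact: cg.
  by apply: continuous_comp; [exact: opp_continuous|exact: continuous_expR].
(* The bound [3 C / x] follows from [(1 + x) x <= 3 e^x], itself a consequence of
   [1 + x^2 / 2 <= e^x]. *)
- apply/norm_cvg0P; apply: (@squeeze_cvgr _ _ _ _ (cst 0) (fun x => (3 * C) / x)); last 2 first.
    exact: cvg_cst.
    exact: cvg_inv_pinfty.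
  near=> x.
  have x0 : 0 < x by near: x; exact: nbhs_pinfty_gt.
  rewrite normr_ge0/=; apply: le_trans (GC x (ltW x0)) _.
  rewrite ler_pdivlMr// expRN mulrAC ler_pdivrMr ?expR_gt0//.
  have h := @expR_ge1Dxn R x 1 (ltW x0).
  have h2 : x ^+ 2 / 2`!%:R = x ^+ 2 / 2 by [].
  rewrite h2 in h.
  have : (1 + x) * x <= expR x * 3 by nra.
  move/(ler_wpM2l C0); lra.
- by move=> x _; exact: ex_derive.
- by apply: cvg_at_right_filter; exact: cG.
- by move=> x _; rewrite derive1E derive_val.
Unshelve. all: by end_near. Qed.

(** Method of undetermined coefficients: the antiderivative is [p(x) e^(-x)] with [p] of the form [a
    + b cos + c sin + x (d + e cos + f sin)], and the integral is [- p(0)]. Each use supplies the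
    six coefficients that fit its integrand. *)
Lemma integral_exp_law_trig (R : realType) (r a b c d e f : R) (h : R -> R) :
  measurable_fun setT h -> (forall x, 0 <= h x) ->
  (forall x, 0 <= x -> h x =
     (d - a) + (e - b + c * r) * cos (x * r) + (f - c - b * r) * sin (x * r)
     + x * (- d + (f * r - e) * cos (x * r) - (e * r + f) * sin (x * r))) ->
  (\int[exp_law R]_x (h x)%:E = (- (a + b))%:E)%E.
Proof.
move=> mh h0 hE.
pose p x := a + b * cos (x * r) + c * sin (x * r)
  + x * (d + e * cos (x * r) + f * sin (x * r)).
have -> : - (a + b) = - (p 0 * expR (- 0)).
  by rewrite /p mul0r cos0 sin0 oppr0 expR0; ring.
have d0 (x : R) : is_derive x 1 (fun x => p x * expR (- x))
   (((d - a) + (e - b + c * r) * cos (x * r) + (f - c - b * r) * sin (x * r)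
     + x * (- d + (f * r - e) * cos (x * r) - (e * r + f) * sin (x * r))) * expR (- x)).
  eapply is_derive1_eq; first by rewrite /p; derive_fun.
  by rewrite /=; ring.
apply: (integral_exp_law_FTC mh h0 hE _ d0
  (C := `|a| + `|b| + `|c| + (`|d| + `|e| + `|f|))).
  move=> x.
  have cr : t * r @[t --> x] --> x * r by apply: cvgMr_tmp; exact: cvg_id.
  have cc : cos (t * r) @[t --> x] --> cos (x * r).
    exact: (cvg_comp _ _ cr (@continuous_cos R (x * r))).
  have cs : sin (t * r) @[t --> x] --> sin (x * r).
    exact: (cvg_comp _ _ cr (@continuous_sin R (x * r))).
  apply: cvgD.
    by do ![apply: cvgD]; first [exact: cvg_cst|apply: cvgMl_tmp].
  apply: cvgM; first exact: cvg_id.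
  apply: cvgB; last exact: cvgMl_tmp.
  by apply: cvgD; [exact: cvg_cst|exact: cvgMl_tmp].
move=> x x0; rewrite normrM (ger0_norm (expR_ge0 _)) ler_wpM2r ?expR_ge0// /p.
have hb (k t : R) : `|t| <= 1 -> `|k * t| <= `|k|.
  by move=> t1; rewrite normrM -[leRHS]mulr1 ler_wpM2l.
have H (k1 k2 k3 : R) : `|k1 + k2 * cos (x * r) + k3 * sin (x * r)| <= `|k1| + `|k2| + `|k3|.
  rewrite (le_trans (ler_normD _ _))// lerD ?hb ?sin_max//.
  by rewrite (le_trans (ler_normD _ _))// lerD ?hb ?cos_max.
rewrite (le_trans (ler_normD _ _))// normrM (ger0_norm x0).
have H1 := H a b c; have H2 := ler_wpM2l x0 (H d e f).
have : 0 <= x * (`|a| + `|b| + `|c|) by rewrite mulr_ge0// !addr_ge0.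
have : 0 <= `|d| + `|e| + `|f| by rewrite !addr_ge0.
lra.
Qed.

(** Says that [A + i B] is the characteristic function of some integrable variable [U] and that
    [A1 + i B1] is [E[U e^(i r U)]]. The probability space is hidden by the quantifier, so that
    independent sums can be built on product spaces by induction. *)
Definition trig_law (R : realType) (A B A1 B1 : R -> R) : Prop :=
  exists (d : measure_display) (E : measurableType d) (Q : probability E R)
         (U : E -> R),
  [/\ measurable_fun setT U, Q.-integrable setT (EFin \o U) &
   forall r, [/\ \int[Q]_e cos (U e * r) = A r, \int[Q]_e sin (U e * r) = B r,
     \int[Q]_e (U e * cos (U e * r)) = A1 r &
     \int[Q]_e (U e * sin (U e * r)) = B1 r]].

Lemma integrable_mul_bounded d (T : measurableType d) (R : realType)
    (mu : {measure set T -> \bar R}) (f h : T -> R) :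
  mu.-integrable setT (EFin \o f) -> measurable_fun setT h ->
  (forall x, `|h x| <= 1) -> mu.-integrable setT (EFin \o (fun x => f x * h x)).
Proof.
move=> fi mh h1; apply: (integrable_dominated (g := fun x => `|f x|)).
- apply: measurable_funM => //; exact/measurable_EFinP/(measurable_int mu fi).
- exact: integrable_norm.
- by move=> x; rewrite normrM -[leRHS]mulr1 ler_wpM2l.
Qed.

(** The real and imaginary parts of [1 / (1 - i r)] and of [1 / (1 - i r)^2]. *)
Lemma trig_law_exp (R : realType) : trig_law
  (fun r : R => (1 + r ^+ 2)^-1) (fun r => r / (1 + r ^+ 2))
  (fun r => (1 - r ^+ 2) / (1 + r ^+ 2) ^+ 2) (fun r => 2 * r / (1 + r ^+ 2) ^+ 2).
Proof.
(* The absolute value changes nothing on the half-line that carries the law, and makes the variable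
   nonnegative everywhere, as the integration lemma requires. *)
pose U (x : R) := `|x|.
have mU : measurable_fun setT U by exact: measurableT_comp.
have U0 x : 0 <= U x by exact: normr_ge0.
have iU1 : (\int[exp_law R]_x (U x)%:E = 1%:E)%E.
  rewrite (@integral_exp_law_trig _ 0 (-1) 0 0 (-1) 0 0)//; first by congr (_%:E); ring.
  by move=> x x0; rewrite /U ger0_norm//; ring.
have iU : (exp_law R).-integrable setT (EFin \o U).
  apply/integrableP; split; first exact/measurable_EFinP.
  apply: le_lt_trans (ltry 1); rewrite -iU1 le_eqVlt; apply/orP; left.
  by apply/eqP; apply: eq_integral => x _ /=; rewrite /U normr_id.
have UE x : 0 <= x -> U x = x by exact: ger0_norm.
have U1 : \int[exp_law R]_x U x = 1 by rewrite /Rintegral iU1.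
clearbody U.
have mcos r : measurable_fun setT (fun x => cos (U x * r)) by mfun.
have msin r : measurable_fun setT (fun x => sin (U x * r)) by mfun.
have icos r : (exp_law R).-integrable setT (EFin \o (fun x => cos (U x * r))).
  by apply: (@integrable_bounded _ (measurableTypeR R) _ (exp_law R) _ 1 (mcos r)) => x; exact: cos_max.
have isin r : (exp_law R).-integrable setT (EFin \o (fun x => sin (U x * r))).
  by apply: (@integrable_bounded _ (measurableTypeR R) _ (exp_law R) _ 1 (msin r)) => x; exact: sin_max.
have i1 : (exp_law R).-integrable setT (EFin \o (fun _ : R => (1 : R))).
  exact: finite_measure_integrable_cst.
exists _, (measurableTypeR R), (exp_law R), U; split => // r.
have k0 : 1 + r ^+ 2 != 0 by rewrite gt_eqF// ltr_pwDl// sqr_ge0.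
set k := 1 + r ^+ 2 in k0 *.
have [cU sU] : (forall x, - 1 <= cos (U x * r)) /\ (forall x, - 1 <= sin (U x * r)).
  by split => x; [exact: cos_geN1|exact: sin_geN1].
split.
(* Adding 1, and in the last two cases [U], makes the integrand nonnegative; the extra term is
   cancelled afterwards. *)
- have : \int[exp_law R]_x (1 + cos (U x * r)) = 1 + k^-1.
    rewrite /Rintegral (@integral_exp_law_trig _ r (-1) (- k^-1) (r / k) 0 0 0)//.
    + by rewrite /=; ring.
    + by mfun.
    + by move=> x x0; rewrite UE// /k; field.
  by rewrite RintegralD// Rintegral_prob_cst => /addrI.
- have : \int[exp_law R]_x (1 + sin (U x * r)) = 1 + r / k.
    rewrite /Rintegral (@integral_exp_law_trig _ r (-1) (- (r / k)) (- k^-1) 0 0 0)//.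
    + by rewrite /=; ring.
    + by mfun.
    + by move=> x x0; rewrite UE// /k; field.
  by rewrite RintegralD// Rintegral_prob_cst => /addrI.
- have : \int[exp_law R]_x (U x + U x * cos (U x * r)) = 1 + (1 - r ^+ 2) / k ^+ 2.
    rewrite /Rintegral (@integral_exp_law_trig _ r (-1) ((r ^+ 2 - 1) / k ^+ 2)
       (2 * r / k ^+ 2) (-1) (- k^-1) (r / k))//.
    + by rewrite /=; ring.
    + by mfun.
    + move=> x; rewrite -[X in X + _]mulr1 -mulrDr mulr_ge0//.
    + by move=> x x0; rewrite UE// /k; field.
  rewrite RintegralD ?U1//; first by move=> /addrI.
  by apply: (integrable_mul_bounded iU (mcos r)) => x; exact: cos_max.
- have : \int[exp_law R]_x (U x + U x * sin (U x * r)) = 1 + 2 * r / k ^+ 2.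
    rewrite /Rintegral (@integral_exp_law_trig _ r (-1) (- (2 * r / k ^+ 2))
       ((r ^+ 2 - 1) / k ^+ 2) (-1) (- (r / k)) (- k^-1))//.
    + by rewrite /=; ring.
    + by mfun.
    + move=> x; rewrite -[X in X + _]mulr1 -mulrDr mulr_ge0//.
    + by move=> x x0; rewrite UE// /k; field.
  rewrite RintegralD ?U1//; first by move=> /addrI.
  by apply: (integrable_mul_bounded iU (msin r)) => x; exact: sin_max.
Qed.

Lemma integrable_prod_mul d1 (T1 : measurableType d1) d2 (T2 : measurableType d2)
    (R : realType) (P1 : {sigma_finite_measure set T1 -> \bar R})
    (P2 : {sigma_finite_measure set T2 -> \bar R})
    (f : T1 -> R) (g : T2 -> R) :
  P1.-integrable setT (EFin \o f) -> P2.-integrable setT (EFin \o g) ->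
  (P1 \x P2)%E.-integrable setT (EFin \o (fun z => f z.1 * g z.2)).
Proof.
move=> fi gi.
have mf : measurable_fun setT f by exact/measurable_EFinP/(measurable_int P1 fi).
have mg : measurable_fun setT g by exact/measurable_EFinP/(measurable_int P2 gi).
have mfg : measurable_fun setT (fun z : T1 * T2 => f z.1 * g z.2).
  by apply: measurable_funM; apply: measurableT_comp => //.
apply/integrable12ltyP; first exact/measurable_EFinP.
have gnE : (\int[P2]_y `|(g y)%:E| = (\int[P2]_y `|g y|)%:E)%E.
  by rewrite fineK//; apply: integrable_fin_num => //; exact: integrable_norm.
have fnE : (\int[P1]_x `|(f x)%:E| = (\int[P1]_x `|f x|)%:E)%E.
  by rewrite fineK//; apply: integrable_fin_num => //; exact: integrable_norm.
rewrite (eq_integral (fun x => `|(f x)%:E| * (\int[P2]_y `|g y|)%:E)%E); last first.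
  move=> x _; rewrite -gnE -ge0_integralZl//; last first.
    by apply: measurableT_comp => //; exact/measurable_EFinP.
  by apply: eq_integral => y _; rewrite /= normrM EFinM.
rewrite ge0_integralZr//; last 2 first.
- by apply: measurableT_comp => //; exact/measurable_EFinP.
- by rewrite lee_fin; apply: Rintegral_ge0 => *; exact: normr_ge0.
by rewrite fnE -EFinM ltry.
Qed.

Lemma Rintegral_prod_mul d1 (T1 : measurableType d1) d2 (T2 : measurableType d2)
    (R : realType) (P1 : probability T1 R) (P2 : probability T2 R)
    (f : T1 -> R) (g : T2 -> R) :
  P1.-integrable setT (EFin \o f) -> P2.-integrable setT (EFin \o g) ->
  \int[(P1 \x P2)%E]_z (f z.1 * g z.2) = (\int[P1]_x f x) * (\int[P2]_y g y).
Proof.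
move=> fi gi; have fgi := integrable_prod_mul fi gi.
have gE : (\int[P2]_y (g y)%:E = (\int[P2]_y g y)%:E)%E.
  by rewrite fineK//; exact: integrable_fin_num.
rewrite [LHS]/Rintegral -integral12_prod_meas1//.
rewrite (eq_integral (fun x => (f x * \int[P2]_y g y)%:E)); last first.
  move=> x _; rewrite /fubini_F/= EFinM -gE -integralZl//.
rewrite -[LHS]/(\int[P1]_x (f x * \int[P2]_y g y)) RintegralZr//.
Qed.

(** The law of the sum of independent variables on a product space. Characteristic functions
    multiply as complex numbers, and the weighted transforms obey the Leibniz rule. *)
Lemma trig_lawD (R : realType) (A B A1 B1 A' B' A1' B1' : R -> R) :
  trig_law A B A1 B1 -> trig_law A' B' A1' B1' ->
  trig_law (fun r => A r * A' r - B r * B' r) (fun r => B r * A' r + A r * B' r)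
    (fun r => A1 r * A' r - B1 r * B' r + (A r * A1' r - B r * B1' r))
    (fun r => B1 r * A' r + A1 r * B' r + (B r * A1' r + A r * B1' r)).
Proof.
move=> [d [E [Q [U [mU iU UE]]]]] [d' [E' [Q' [U' [mU' iU' UE']]]]].
have mc r : measurable_fun setT (fun x => cos (U x * r)) by mfun.
have ms r : measurable_fun setT (fun x => sin (U x * r)) by mfun.
have mc' r : measurable_fun setT (fun x => cos (U' x * r)) by mfun.
have ms' r : measurable_fun setT (fun x => sin (U' x * r)) by mfun.
have ic r : Q.-integrable setT (EFin \o (fun x => cos (U x * r))).
  by apply: (@integrable_bounded _ _ _ _ _ 1) => // x; exact: cos_max.
have isn r : Q.-integrable setT (EFin \o (fun x => sin (U x * r))).
  by apply: (@integrable_bounded _ _ _ _ _ 1) => // x; exact: sin_max.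
have ic' r : Q'.-integrable setT (EFin \o (fun x => cos (U' x * r))).
  by apply: (@integrable_bounded _ _ _ _ _ 1) => // x; exact: cos_max.
have isn' r : Q'.-integrable setT (EFin \o (fun x => sin (U' x * r))).
  by apply: (@integrable_bounded _ _ _ _ _ 1) => // x; exact: sin_max.
have iUc r : Q.-integrable setT (EFin \o (fun x => U x * cos (U x * r))).
  by apply: integrable_mul_bounded => // x; exact: cos_max.
have iUs r : Q.-integrable setT (EFin \o (fun x => U x * sin (U x * r))).
  by apply: integrable_mul_bounded => // x; exact: sin_max.
have iUc' r : Q'.-integrable setT (EFin \o (fun x => U' x * cos (U' x * r))).
  by apply: integrable_mul_bounded => // x; exact: cos_max.
have iUs' r : Q'.-integrable setT (EFin \o (fun x => U' x * sin (U' x * r))).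
  by apply: integrable_mul_bounded => // x; exact: sin_max.
pose QQ : probability _ R := (Q \x Q')%E.
have i1 : Q.-integrable setT (EFin \o (fun _ => 1 : R)).
  exact: finite_measure_integrable_cst.
have i1' : Q'.-integrable setT (EFin \o (fun _ => 1 : R)).
  exact: finite_measure_integrable_cst.
exists _, (E * E')%type, QQ, (fun z => U z.1 + U' z.2); split.
- by apply: measurable_funD; apply: measurableT_comp.
- have h1 := integrable_prod_mul iU i1'; have h2 := integrable_prod_mul i1 iU'.
  have := integrableD measurableT h1 h2; apply: eq_integrable => // x _ /=.
  by rewrite mulr1 mul1r.
move=> r; have [UA UB UA1 UB1] := UE r; have [UA' UB' UA1' UB1'] := UE' r.
have M f g := @Rintegral_prod_mul _ E _ E' R Q Q' f g.
have Mi f g := @integrable_prod_mul _ E _ E' R Q Q' f g.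
have iD (f g : E * E' -> R) : QQ.-integrable setT (EFin \o f) ->
    QQ.-integrable setT (EFin \o g) -> QQ.-integrable setT (EFin \o (fun z => f z + g z)).
  by move=> fi gi; rewrite /comp; under eq_fun do rewrite EFinD; exact: integrableD.
have iB (f g : E * E' -> R) : QQ.-integrable setT (EFin \o f) ->
    QQ.-integrable setT (EFin \o g) -> QQ.-integrable setT (EFin \o (fun z => f z - g z)).
  by move=> fi gi; rewrite /comp; under eq_fun do rewrite EFinB; exact: integrableB.
have cc := Mi _ _ (ic r) (ic' r); have ss := Mi _ _ (isn r) (isn' r).
have sc := Mi _ _ (isn r) (ic' r); have cs := Mi _ _ (ic r) (isn' r).
have Ucc := Mi _ _ (iUc r) (ic' r); have Uss := Mi _ _ (iUs r) (isn' r).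
have cUc := Mi _ _ (ic r) (iUc' r); have sUs := Mi _ _ (isn r) (iUs' r).
have Usc := Mi _ _ (iUs r) (ic' r); have Ucs := Mi _ _ (iUc r) (isn' r).
have sUc := Mi _ _ (isn r) (iUc' r); have cUs := Mi _ _ (ic r) (iUs' r).
split.
- rewrite -UA -UB -UA' -UB' -!M// -RintegralB//.
  by apply: eq_Rintegral => z _; rewrite /= [(_ + _) * r]mulrDl cosD.
- rewrite -UA -UB -UA' -UB' -!M// -RintegralD//.
  by apply: eq_Rintegral => z _; rewrite /= [(_ + _) * r]mulrDl sinD.
- rewrite -UA -UB -UA' -UB' -UA1 -UB1 -UA1' -UB1' -!M//.
  rewrite -!RintegralB// -RintegralD//; [|exact: iB..].
  by apply: eq_Rintegral => z _; rewrite /= [(_ + _) * r]mulrDl cosD; ring.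
- rewrite -UA -UB -UA' -UB' -UA1 -UB1 -UA1' -UB1' -!M//.
  rewrite -!RintegralD//; [|exact: iD..].
  by apply: eq_Rintegral => z _; rewrite /= [(_ + _) * r]mulrDl sinD; ring.
Qed.

Lemma trig_lawN (R : realType) (A B A1 B1 : R -> R) : trig_law A B A1 B1 ->
  trig_law A (fun r => - B r) (fun r => - A1 r) B1.
Proof.
move=> [d [E [Q [U [mU iU UE]]]]].
exists d, E, Q, (fun x => - U x); split.
- exact: measurableT_comp.
- by have := integrableN iU; apply: eq_integrable.
move=> r; have [<- <- <- <-] := UE r.
have iUc : Q.-integrable setT (EFin \o (fun x => U x * cos (U x * r))).
  by apply: integrable_mul_bounded => //; [mfun|move=> x; exact: cos_max].
have isn : Q.-integrable setT (EFin \o (fun x => sin (U x * r))).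
  by apply: (@integrable_bounded _ _ _ _ _ 1); [mfun|move=> x; exact: sin_max].
split.
- by apply: eq_Rintegral => x _; rewrite mulNr cosN.
- rewrite -[RHS]mulN1r -RintegralZl//.
  by apply: eq_Rintegral => x _; rewrite mulNr sinN mulN1r.
- rewrite -[RHS]mulN1r -RintegralZl//.
  by apply: eq_Rintegral => x _; rewrite [- _ * r]mulNr cosN; ring.
- by apply: eq_Rintegral => x _; rewrite [- _ * r]mulNr sinN; ring.
Qed.

(* Convolution powers of the Laplace law, the law of the difference of two
   independent standard exponential variables. *)
Lemma trig_law_laplaceX (R : realType) (n : nat) : trig_law
  (fun r : R => (1 + r ^+ 2) ^- n) (fun=> 0) (fun=> 0)
  (fun r => n%:R * (2 * r) * (1 + r ^+ 2) ^- n.+1).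
Proof.
have k0 (r : R) : 1 + r ^+ 2 != 0 by rewrite gt_eqF// ltr_pwDl// sqr_ge0.
elim: n => [|n ih].
  exists _, unit, (dirac tt), (fun=> 0); split.
  - exact: measurable_cst.
  - exact: finite_measure_integrable_cst.
  move=> r; rewrite mul0r cos0 sin0 !mul0r expr0 invr1.
  by rewrite !(Rintegral_prob_cst (dirac tt)).
have e := trig_law_exp R; have := trig_lawD (trig_lawD e (trig_lawN e)) ih.
congr trig_law; apply/funext => r; have kr := k0 r;
  rewrite ?[_ ^+ n.+2]exprS ?[_ ^+ n.+1]exprS ?invfM;
  move: ((_ ^+ n)^-1) => t; rewrite -?natr1; by field.
Qed.

Lemma integrable_fubini_G d1 (T1 : measurableType d1) d2 (T2 : measurableType d2)
    (R : realType) (m1 : {sigma_finite_measure set T1 -> \bar R})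
    (m2 : {sigma_finite_measure set T2 -> \bar R}) (f : T1 * T2 -> \bar R) :
  (m1 \x m2)%E.-integrable setT f -> m2.-integrable setT (fubini_G m1 f).
Proof.
move=> fi; have mf := measurable_int _ fi.
have mG := measurable_fubini_G fi.
have /integrable21ltyP-/(_ mf) foo := fi.
apply/integrableP; split => //; apply: le_lt_trans foo.
have mN : measurable_fun setT (fun y => \int[m1]_x `|f (x, y)|)%E.
  apply: (@measurable_fun_fubini_tonelli_G _ _ _ _ _ m1 (fun z => `|f z|)%E) => //.
  exact: measurableT_comp.
apply: ge0_le_integral => //.
- exact: measurableT_comp.
- move=> y _; apply: le_abse_integral => //.
  exact: measurableT_comp.
Qed.

Lemma Rintegral_fubini d1 (T1 : measurableType d1) d2 (T2 : measurableType d2)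
    (R : realType) (m1 : {sigma_finite_measure set T1 -> \bar R})
    (m2 : {sigma_finite_measure set T2 -> \bar R}) (f : T1 * T2 -> R) :
  (m1 \x m2)%E.-integrable setT (EFin \o f) ->
  (forall x, m2.-integrable setT (EFin \o (fun y => f (x, y)))) ->
  (forall y, m1.-integrable setT (EFin \o (fun x => f (x, y)))) ->
  [/\ m1.-integrable setT (EFin \o (fun x => \int[m2]_y f (x, y))),
      m2.-integrable setT (EFin \o (fun y => \int[m1]_x f (x, y))) &
      \int[m1]_x \int[m2]_y f (x, y) = \int[m2]_y \int[m1]_x f (x, y)].
Proof.
move=> fi f2 f1.
have E2 x : (\int[m2]_y (f (x, y))%:E = (\int[m2]_y f (x, y))%:E)%E.
  by rewrite fineK//; exact: integrable_fin_num (f2 x).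
have E1 y : (\int[m1]_x (f (x, y))%:E = (\int[m1]_x f (x, y))%:E)%E.
  by rewrite fineK//; exact: integrable_fin_num (f1 y).
split.
- by have := integrable_fubini_F fi; apply: eq_integrable => // x _; exact: E2.
- by have := integrable_fubini_G fi; apply: eq_integrable => // y _; exact: E1.
- congr fine; transitivity (\int[m1]_x \int[m2]_y (f (x, y))%:E)%E.
    by apply: eq_integral => x _; rewrite E2.
  by rewrite (Fubini fi); apply: eq_integral => y _; exact: E1.
Qed.

Lemma ae_le_Rintegral d (T : measurableType d) (R : realType)
    (mu : {measure set T -> \bar R}) (f g : T -> R) :
  mu.-integrable setT (EFin \o f) -> mu.-integrable setT (EFin \o g) ->
  {ae mu, forall x, f x <= g x} -> \int[mu]_x f x <= \int[mu]_x g x.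
Proof.
move=> fi gi fg.
have mf : measurable_fun setT f by exact/measurable_EFinP/(measurable_int mu fi).
have mg : measurable_fun setT g by exact/measurable_EFinP/(measurable_int mu gi).
have mm : measurable_fun setT (fun x => Num.min (f x) (g x)) by exact: measurable_minr.
(* Replacing [f] by [min f g], almost everywhere equal to it, turns the comparison into a pointwise
   one. *)
have -> : \int[mu]_x f x = \int[mu]_x Num.min (f x) (g x).
  congr fine; apply: ae_eq_integral => //; [exact/measurable_EFinP..|].
  by apply: filterS fg => x fg _; rewrite min_l.
apply: le_Rintegral => //; last by move=> x _; rewrite ge_min lexx orbT.
apply: (@integrable_dominated _ _ _ _ _ (fun x => `|f x| + `|g x|)) => //.
  rewrite /comp; under eq_fun do rewrite EFinD.
  by apply: integrableD => //; exact: integrable_norm.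
by move=> x; rewrite /Num.min; case: ifP => _; rewrite ?lerDl ?lerDr.
Qed.

(** * The averaged Stein inequality *)

Section stein_bound.
Context (R : realType) d1 (T1 : measurableType d1) (P : probability T1 R)
  d2 (T2 : measurableType d2) (nu : {sigma_finite_measure set T2 -> \bar R}).
Variables (Y : T1 -> R) (y : T2 -> R) (a b V : R).
Hypotheses (mY : measurable_fun setT Y) (my : measurable_fun setT y)
  (a0 : 0 <= a) (b0 : 0 < b)
  (iY : P.-integrable setT (EFin \o Y))
  (iy2 : nu.-integrable setT (EFin \o (fun x => y x ^+ 2)))
  (aV : a + \int[nu]_x (y x ^+ 2) <= V)
  (yb : {ae nu, forall x, y x <= b})
  (stein : forall p q,
    \int[P]_x (Y x * cos (p + q * Y x)) =
    - (q * a + levy_alpha nu y q) * \int[P]_x sin (p + q * Y x)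
    + levy_beta nu y q * \int[P]_x cos (p + q * Y x)).

Let m2 := \int[nu]_x (y x ^+ 2).

Let alpha_le q : `|levy_alpha nu y q| <= `|q| * m2.
Proof.
rewrite (le_trans (le_normr_Rintegral _ _))//; first exact: (integrable_levy_alpha my iy2).
rewrite -RintegralZl//; apply: le_Rintegral => //.
- by apply: integrable_norm; exact: (integrable_levy_alpha my iy2).
- by rewrite /comp; under eq_fun do rewrite EFinM; exact: integrableZl.
move=> x _; rewrite normrM -(real_normK (num_real (y x))).
have := normr_sin_le (q * y x); rewrite normrM.
by have := normr_ge0 (y x); nra.
Qed.

Let beta_le q : `|levy_beta nu y q| <= `|q| * m2.
Proof.
rewrite (le_trans (le_normr_Rintegral _ _))//; first exact: (integrable_levy_beta my iy2).
rewrite -RintegralZl//; apply: le_Rintegral => //.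
- by apply: integrable_norm; exact: (integrable_levy_beta my iy2).
- by rewrite /comp; under eq_fun do rewrite EFinM; exact: integrableZl.
move=> x _; rewrite normrM -(real_normK (num_real (y x))).
have := normr_cosB_le (q * y x) 0; rewrite cos0 subr0 normrM.
by have := normr_ge0 (y x); nra.
Qed.

Variables (h : R) (n : nat).
Hypothesis h0 : 0 < h.

(** The value of [E cos (U (1 - h x))] for [U] a sum of [n] independent Laplace variables; [2^n]
    times it approximates [e^(n h x)] for small [h]. *)
Definition laplace_test (x : R) := (1 + (1 - h * x) ^+ 2) ^- n.
Local Notation F := laplace_test.
Let kappa := (expR (n%:R * h * b) - 1) / b.

Let k_gt0 (r : R) : 0 < 1 + r ^+ 2. Proof. by rewrite ltr_pwDl// sqr_ge0. Qed.

Lemma laplace_test_gt0 x : 0 < F x.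
Proof. by rewrite /laplace_test invr_gt0 exprn_gt0. Qed.

Lemma laplace_test_le1 x : F x <= 1.
Proof.
by rewrite /laplace_test invf_le1 ?exprn_gt0// exprn_ege1// lerDl sqr_ge0.
Qed.

Lemma measurable_laplace_test : measurable_fun setT F.
Proof.
apply: continuous_measurable_fun => x.
apply: cvgV; first by rewrite gt_eqF// exprn_gt0.
apply: (@cvg_comp _ _ _ (fun x => 1 + (1 - h * x) ^+ 2) (fun x => x ^+ n)); last first.
  exact: exprn_continuous.
apply: cvgD; first exact: cvg_cst.
rewrite expr2; under eq_cvg do rewrite expr2.
have c : 1 - h * t @[t --> x] --> 1 - h * x.
  by apply: cvgB; [exact: cvg_cst|apply: cvgMl_tmp; exact: cvg_id].
exact: cvgM.
Qed.

(** The [n]-th power of [ler_expR_sqr1D], at the points [1 - h (z + t) <= 1 - h z]. *)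
Let laplace_shift_ge0 z t : 0 <= t -> F (z + t) <= expR (n%:R * h * t) * F z.
Proof.
move=> t0; rewrite /laplace_test.
have ht : 0 <= h * t by rewrite mulr_ge0// ltW.
have := @ler_expR_sqr1D R (1 - h * (z + t)) (1 - h * z).
rewrite (_ : 1 - h * z - (1 - h * (z + t)) = h * t); last by ring.
move=> /(_ _); rewrite -subr_ge0.
rewrite (_ : 1 - h * z - (1 - h * (z + t)) = h * t); last by ring.
move=> /(_ ht) H.
rewrite -ler_pdivrMr; last by rewrite invr_gt0 exprn_gt0.
rewrite invrK -exprVn -exprMn -mulrA expRM_natl.
rewrite lerXn2r ?nnegrE ?expR_ge0//.
  by rewrite mulr_ge0 ?invr_ge0 ?ltW ?k_gt0.
by rewrite mulrC ler_pdivrMr ?k_gt0.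
Qed.

(** The factor [t] makes the bound valid for both signs: for [t < 0] the previous lemma is applied
    from [z + t] back to [z], and the negative factor reverses the inequality. *)
Let laplace_shift z t : t * F (z + t) <= t * (expR (n%:R * h * t) * F z).
Proof.
have [t0|t0] := leP 0 t; first by rewrite ler_wpM2l// laplace_shift_ge0.
rewrite ler_wnM2l ?(ltW t0)//.
have nt0 : 0 <= - t by lra.
have := laplace_shift_ge0 (z + t) nt0; rewrite addrK => H.
have := ler_wpM2l (expR_ge0 (n%:R * h * t)) H.
by rewrite mulrA -expRD mulrN subrr expR0 mul1r.
Qed.

Let nh_le_kappa : n%:R * h <= kappa.
Proof.
rewrite /kappa ler_pdivlMr// lerBrDl; exact: expR_ge1Dx.
Qed.

Let kappa0 : 0 <= kappa.
Proof. by apply: le_trans nh_le_kappa; rewrite mulr_ge0// ltW. Qed.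

(** The shift bound reduces the increment of [F] to [e^(n h t) - 1], to which the chord bound
    [expR_chord] applies; [kappa] is the slope of that chord. This is where the bound on positive
    jumps enters. *)
Let increment_le z t : t <= b -> t * (F (z + t) - F z) <= t ^+ 2 * kappa * F z.
Proof.
move=> tb; have := expR_chord (n%:R * h) b0 tb; rewrite -/kappa.
have := laplace_shift z t; have := ltW (laplace_test_gt0 z).
move=> F0 H1 H2; have := ler_wpM2r F0 H2; lra.
Qed.

Lemma laplace_test_stein_le :
  \int[P]_x (Y x * F (Y x)) <= kappa * V * \int[P]_x F (Y x).
Proof.
have [d [E [Q [U [mU iU UE]]]]] := trig_law_laplaceX R n.
have iUn : Q.-integrable setT (EFin \o (fun e => `|U e|)) by exact: integrable_norm.
pose q e := - h * U e.
have mq : measurable_fun setT q by apply: measurable_funM.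
have qn e : `|q e| = h * `|U e| by rewrite /q normrM normrN (gtr0_norm h0).
(* This function is integrated in both orders: over [nu] it gives the [beta] and [alpha] terms of
   the Stein identity, over [Q] it gives [y (F (z + y) - F z)], to which [increment_le] applies. *)
pose jump z (w : E * T2) :=
  y w.2 * (cos (U w.1 * (1 - h * (z + y w.2))) - cos (U w.1 * (1 - h * z))).
have mU1 : measurable_fun setT (fun w : E * T2 => U w.1) by apply: measurableT_comp.
have my2 : measurable_fun setT (fun w : E * T2 => y w.2) by apply: measurableT_comp.
have mq1 : measurable_fun setT (fun w : E * T2 => q w.1) by apply: measurableT_comp.
have idom : (Q \x nu)%E.-integrable setT
    (EFin \o (fun w => h * (`|U w.1| * y w.2 ^+ 2))).
  have := integrable_prod_mul iUn iy2.
  rewrite /comp; under [X in _ -> _.-integrable _ X]eq_fun do rewrite EFinM.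
  exact: integrableZl.
have ijump z : (Q \x nu)%E.-integrable setT (EFin \o jump z).
  apply: (integrable_dominated _ idom); first by rewrite /jump; mfun.
  move=> w; rewrite /jump normrM -(real_normK (num_real (y w.2))).
  have := normr_cosB_le (U w.1 * (1 - h * (z + y w.2))) (U w.1 * (1 - h * z)).
  rewrite (_ : U w.1 * _ - U w.1 * _ = - h * U w.1 * y w.2); last by ring.
  rewrite !normrM normrN (gtr0_norm h0); have := normr_ge0 (y w.2); nra.
(* Measurability in the random frequency is obtained by reading the drift as the inner integral of a
   function integrable on the product space. *)
have malpha : measurable_fun setT (fun e => levy_alpha nu y (q e)).
  have i : (Q \x nu)%E.-integrable setT (EFin \o (fun w => y w.2 * sin (q w.1 * y w.2))).
    apply: (integrable_dominated _ idom); first by mfun.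
    move=> w; rewrite normrM -(real_normK (num_real (y w.2))).
    have := normr_sin_le (q w.1 * y w.2); rewrite normrM qn.
    have := normr_ge0 (y w.2); nra.
  exact: measurableT_comp (measurable_fubini_F i).
have mbeta : measurable_fun setT (fun e => levy_beta nu y (q e)).
  have i : (Q \x nu)%E.-integrable setT (EFin \o (fun w => y w.2 * (cos (q w.1 * y w.2) - 1))).
    apply: (integrable_dominated _ idom); first by mfun.
    move=> w; rewrite normrM -(real_normK (num_real (y w.2))).
    have := normr_cosB_le (q w.1 * y w.2) 0; rewrite cos0 subr0 normrM qn.
    have := normr_ge0 (y w.2); nra.
  exact: measurableT_comp (measurable_fubini_F i).
(* The Stein identity at [p = U], [q = - h U], with all terms on one side. Its [P]-mean vanishes for
   each value of [U] ([Z0]), its [Q]-mean has a lower bound at each value of [Y] ([ZQ]), and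
   exchanging the integrals yields the claim. *)
pose Z (w : E * T1) := Y w.2 * cos (U w.1 * (1 - h * Y w.2))
  + (q w.1 * a) * sin (U w.1 * (1 - h * Y w.2))
  - (levy_beta nu y (q w.1) * cos (U w.1 * (1 - h * Y w.2))
     - levy_alpha nu y (q w.1) * sin (U w.1 * (1 - h * Y w.2))).
have rE e x : U e * (1 - h * Y x) = U e + q e * Y x by rewrite /q; ring.
have i1 : Q.-integrable setT (EFin \o (fun _ => 1 : R)).
  exact: finite_measure_integrable_cst.
have i1' : P.-integrable setT (EFin \o (fun _ => 1 : R)).
  exact: finite_measure_integrable_cst.
have iYn : P.-integrable setT (EFin \o (fun x => `|Y x|)) by exact: integrable_norm.
pose domZ (w : E * T1) := 1 * `|Y w.2| + h * (a + 2 * m2) * (`|U w.1| * 1).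
have Zle w : `|Z w| <= domZ w.
  rewrite /Z /domZ; set th := U w.1 * _.
  have c1 := cos_max th; have s1 := sin_max th.
  have al := alpha_le (q w.1); have be := beta_le (q w.1); rewrite qn in al be.
  have bd (u v M : R) : `|u| <= M -> `|v| <= 1 -> `|u * v| <= M.
    by move=> uM v1; rewrite normrM -[leRHS]mulr1 ler_pM.
  have B1 : `|Y w.2 * cos th| <= `|Y w.2| by exact: bd.
  have B2 : `|q w.1 * a * sin th| <= h * `|U w.1| * a.
    by apply: bd => //; rewrite normrM qn (ger0_norm a0).
  have B3 := bd _ _ _ be c1; have B4 := bd _ _ _ al s1.
  rewrite (le_trans (ler_normB _ _))//.
  have := ler_normD (Y w.2 * cos th) (q w.1 * a * sin th).
  have := ler_normB (levy_beta nu y (q w.1) * cos th) (levy_alpha nu y (q w.1) * sin th).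
  lra.
have iZ : (Q \x P)%E.-integrable setT (EFin \o Z).
  have idomZ : (Q \x P)%E.-integrable setT (EFin \o domZ).
    have j1 := integrable_prod_mul i1 iYn.
    have j2 := integrable_prod_mul iUn i1'.
    rewrite /comp; under eq_fun do rewrite EFinD.
    apply: integrableD => //.
    under eq_fun do rewrite EFinM.
    exact: integrableZl.
  apply: (integrable_dominated _ idomZ Zle).
  have mU2 : measurable_fun setT (fun w : E * T1 => U w.1) by apply: measurableT_comp.
  have mY2 : measurable_fun setT (fun w : E * T1 => Y w.2) by apply: measurableT_comp.
  have mq2 : measurable_fun setT (fun w : E * T1 => q w.1) by apply: measurableT_comp.
  have ma2 : measurable_fun setT (fun w : E * T1 => levy_alpha nu y (q w.1)).
    by apply: (measurableT_comp malpha).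
  have mb2 : measurable_fun setT (fun w : E * T1 => levy_beta nu y (q w.1)).
    by apply: (measurableT_comp mbeta).
  by rewrite /Z; mfun.
have iZP e : P.-integrable setT (EFin \o (fun x => Z (e, x))).
  apply: (@integrable_dominated _ _ _ _ _ (fun x => domZ (e, x))) => //.
    by rewrite /Z/=; mfun.
  rewrite /domZ/= /comp; under eq_fun do rewrite EFinD EFinM.
  apply: integrableD => //; first exact: integrableZl.
  exact: finite_measure_integrable_cst.
have iZQ x : Q.-integrable setT (EFin \o (fun e => Z (e, x))).
  apply: (@integrable_dominated _ _ _ _ _ (fun e => domZ (e, x))) => //.
    by rewrite /Z/=; mfun.
  rewrite /domZ/= /comp; under eq_fun do rewrite mulr1 EFinD [X in (_ + X)%E]EFinM.
  apply: integrableD => //; last exact: integrableZl.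
  exact: finite_measure_integrable_cst.
have Z0 e : \int[P]_x Z (e, x) = 0.
  have ic : P.-integrable setT (EFin \o (fun x => cos (U e + q e * Y x))).
    by apply: (@integrable_bounded _ _ _ _ _ 1); [mfun|move=> x; exact: cos_max].
  have isn : P.-integrable setT (EFin \o (fun x => sin (U e + q e * Y x))).
    by apply: (@integrable_bounded _ _ _ _ _ 1); [mfun|move=> x; exact: sin_max].
  have iYc : P.-integrable setT (EFin \o (fun x => Y x * cos (U e + q e * Y x))).
    by apply: integrable_mul_bounded => //; [mfun|move=> x; exact: cos_max].
  have iC c f : P.-integrable setT (EFin \o f) -> P.-integrable setT (EFin \o (fun x => c * f x)).
    by move=> fi; rewrite /comp; under eq_fun do rewrite EFinM; exact: integrableZl.
  transitivity (\int[P]_x (Y x * cos (U e + q e * Y x)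
     + ((q e * a + levy_alpha nu y (q e)) * sin (U e + q e * Y x)
        - levy_beta nu y (q e) * cos (U e + q e * Y x)))).
    by apply: eq_Rintegral => x _; rewrite /Z/= !rE; ring.
  rewrite RintegralD//; last first.
    rewrite /comp; under eq_fun do rewrite EFinB.
    by apply: integrableB => //; exact: iC.
  rewrite RintegralB//; [|exact: iC..].
  by rewrite !RintegralZl// stein; ring.
have ZQ x : \int[Q]_e Z (e, x) >= Y x * F (Y x) - kappa * V * F (Y x).
  have [UA UB UA1 UB1] := UE (1 - h * Y x).
  set r := 1 - h * Y x in UA UB UA1 UB1.
  have ic : Q.-integrable setT (EFin \o (fun e => cos (U e * r))).
    by apply: (@integrable_bounded _ _ _ _ _ 1); [mfun|move=> e; exact: cos_max].
  have iUs : Q.-integrable setT (EFin \o (fun e => U e * sin (U e * r))).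
    by apply: integrable_mul_bounded => //; [mfun|move=> e; exact: sin_max].
  have iC c f : Q.-integrable setT (EFin \o f) -> Q.-integrable setT (EFin \o (fun x => c * f x)).
    by move=> fi; rewrite /comp; under eq_fun do rewrite EFinM; exact: integrableZl.
  (* Addition formula: [cos (U r + q y) - cos (U r) = cos (U r) (cos (q y) - 1) - sin (U r) sin (q
     y)], multiplied by [y] and integrated. *)
  have jE e : levy_beta nu y (q e) * cos (U e * r) - levy_alpha nu y (q e) * sin (U e * r)
      = \int[nu]_t jump (Y x) (e, t).
    rewrite -RintegralZr//; last exact: (integrable_levy_beta my iy2).
    rewrite -RintegralZr//; last exact: (integrable_levy_alpha my iy2).
    have iCr c f : nu.-integrable setT (EFin \o f) -> nu.-integrable setT (EFin \o (fun x => f x * c)).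
      by move=> fi; rewrite /comp; under eq_fun do rewrite EFinM; exact: integrableZr.
    rewrite -RintegralB//; last 2 first.
      by apply: iCr; exact: (integrable_levy_beta my iy2).
      by apply: iCr; exact: (integrable_levy_alpha my iy2).
    apply: eq_Rintegral => t _; rewrite /jump/= -/r.
    have -> : U e * (1 - h * (Y x + y t)) = U e * r + q e * y t by rewrite /q /r; ring.
    by rewrite cosD; ring.
  have ijnu e : nu.-integrable setT (EFin \o (fun t => jump (Y x) (e, t))).
    apply: (@integrable_dominated _ _ _ _ _ (fun t => h * `|U e| * y t ^+ 2)).
    - by rewrite /jump/=; mfun.
    - by rewrite /comp; under eq_fun do rewrite EFinM; exact: integrableZl.
    - move=> t; rewrite /jump/= normrM -(real_normK (num_real (y t))).
      have := normr_cosB_le (U e * (1 - h * (Y x + y t))) (U e * (1 - h * Y x)).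
      rewrite (_ : U e * _ - U e * _ = - h * U e * y t); last by ring.
      rewrite !normrM normrN (gtr0_norm h0); have := normr_ge0 (y t); nra.
  have ijQ : Q.-integrable setT (EFin \o (fun e => \int[nu]_t jump (Y x) (e, t))).
    have := integrable_fubini_F (ijump (Y x)).
    apply: eq_integrable => // e _; rewrite /fubini_F/= fineK//.
    exact: integrable_fin_num (ijnu e).
  have -> : \int[Q]_e Z (e, x) = \int[Q]_e (Y x * cos (U e * r)
      + (- h * a) * (U e * sin (U e * r)) - \int[nu]_t jump (Y x) (e, t)).
    by apply: eq_Rintegral => e _; rewrite /Z/= -/r jE /q; ring.
  rewrite RintegralB//; last first.
    by rewrite /comp; under eq_fun do rewrite EFinD; apply: integrableD => //; exact: iC.
  rewrite RintegralD//; [|exact: iC..].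
  rewrite !RintegralZl// UA UB1.
  have FE : (1 + r ^+ 2) ^- n = F (Y x) by [].
  rewrite FE.
  have jump_le : \int[Q]_e \int[nu]_t jump (Y x) (e, t) <= kappa * m2 * F (Y x).
    have inu e : nu.-integrable setT (EFin \o (fun t => jump (Y x) (e, t))).
      exact: ijnu.
    have iQ t : Q.-integrable setT (EFin \o (fun e => jump (Y x) (e, t))).
      by rewrite /jump/=; apply: iC; rewrite /comp; under eq_fun do rewrite EFinB;
        apply: integrableB => //;
        apply: (@integrable_bounded _ _ _ _ _ 1); [mfun|move=> e; exact: cos_max].
    have [_ iN ->] := Rintegral_fubini (ijump (Y x)) inu iQ.
    have -> : kappa * m2 * F (Y x) = \int[nu]_t (kappa * F (Y x) * y t ^+ 2).
      by rewrite RintegralZl// -/m2; ring.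
    apply: ae_le_Rintegral => //.
      by rewrite /comp; under eq_fun do rewrite EFinM; exact: integrableZl.
    apply: filterS yb => t yt.
    have [UA' _ _ _] := UE (1 - h * (Y x + y t)).
    rewrite /jump/= RintegralZl//; last first.
      rewrite /comp; under eq_fun do rewrite EFinB.
      by apply: integrableB => //;
        apply: (@integrable_bounded _ _ _ _ _ 1); [mfun|move=> e; exact: cos_max].
    rewrite RintegralB//; last first.
      by apply: (@integrable_bounded _ _ _ _ _ 1); [mfun|move=> e; exact: cos_max].
    rewrite UA' UA FE; have := increment_le (Y x) yt; rewrite /laplace_test; lra.
  (* The Gaussian component behaves like jumps of size zero: [2 r <= 1 + r^2] leaves the slope
     [n h], which is at most the chord slope [kappa]. *)
  have drift_le : n%:R * (2 * r) * (1 + r ^+ 2) ^- n.+1 <= n%:R * F (Y x).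
    rewrite -FE exprS invfM -!mulrA ler_wpM2l// !mulrA ler_piMl ?(ltW (laplace_test_gt0 _))//.
    by rewrite ler_pdivrMr// mul1r; have := sqr_ge0 (r - 1); lra.
  have F0 := ltW (laplace_test_gt0 (Y x)).
  have t1 : h * a * (n%:R * (2 * r) * (1 + r ^+ 2) ^- n.+1) <= a * kappa * F (Y x).
    apply: (@le_trans _ _ (h * a * (n%:R * F (Y x)))).
      by rewrite ler_wpM2l// mulr_ge0// ltW.
    have := ler_wpM2r (mulr_ge0 a0 F0) nh_le_kappa; lra.
  have t2 := ler_wpM2r (mulr_ge0 kappa0 F0) aV; rewrite -/m2 in t2.
  lra.
have [_ iPZ swap] := Rintegral_fubini iZ iZP iZQ.
have : \int[P]_x \int[Q]_e Z (e, x) = 0.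
  by rewrite -swap -[RHS](Rintegral_prob_cst Q 0); apply: eq_Rintegral => e _; exact: Z0.
have mFY : measurable_fun setT (fun x => F (Y x)).
  exact: measurableT_comp measurable_laplace_test mY.
have F1 x : `|F (Y x)| <= 1.
  by rewrite (gtr0_norm (laplace_test_gt0 _)) laplace_test_le1.
have iF : P.-integrable setT (EFin \o (fun x => F (Y x))).
  exact: (integrable_bounded P mFY F1).
have iYF : P.-integrable setT (EFin \o (fun x => Y x * F (Y x))).
  exact: integrable_mul_bounded.
have icF : P.-integrable setT (EFin \o (fun x => kappa * V * F (Y x))).
  by rewrite /comp; under eq_fun do rewrite EFinM; exact: integrableZl.
have : \int[P]_x (Y x * F (Y x) - kappa * V * F (Y x)) <= \int[P]_x \int[Q]_e Z (e, x).
  apply: le_Rintegral => //.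
  by rewrite /comp; under eq_fun do rewrite EFinB; exact: integrableB.
rewrite RintegralB// RintegralZl//; lra.
Qed.

End stein_bound.

(** * Discrete Gronwall argument and Bennett's inequality *)

(** [1 / (1 - x) = 1 + x / (1 - x) <= e^(x / (1 - x))]. The common bound [w] turns a product of such
    factors into one exponential of a sum, with a loss [1 / (1 - w)] that tends to 1 as [w] tends to
    0. *)
Lemma expR_mulVr_le (R : realType) (x w : R) : 0 <= x -> x <= w -> w < 1 ->
  (1 - x)^-1 <= expR (x / (1 - w)).
Proof.
move=> x0 xw w1; apply: (@le_trans _ _ (expR (x / (1 - x)))).
  apply: le_trans (expR_ge1Dx _).
  by rewrite le_eqVlt; apply/orP; left; apply/eqP; field; rewrite gt_eqF//; lra.
by rewrite ler_expR ler_wpM2l// lef_pV2 ?posrE; lra.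
Qed.

Section bennett.
Context (R : realType) d1 (T1 : measurableType d1) (P : probability T1 R)
  d2 (T2 : measurableType d2) (nu : {sigma_finite_measure set T2 -> \bar R}).
Variables (Y : T1 -> R) (y : T2 -> R) (a b V : R).
Hypotheses (mY : measurable_fun setT Y) (my : measurable_fun setT y)
  (a0 : 0 <= a) (b0 : 0 < b)
  (iY : P.-integrable setT (EFin \o Y))
  (iy2 : nu.-integrable setT (EFin \o (fun x => y x ^+ 2)))
  (aV : a + \int[nu]_x (y x ^+ 2) <= V)
  (yb : {ae nu, forall x, y x <= b})
  (stein : forall p q,
    \int[P]_x (Y x * cos (p + q * Y x)) =
    - (q * a + levy_alpha nu y q) * \int[P]_x sin (p + q * Y x)
    + levy_beta nu y q * \int[P]_x cos (p + q * Y x)).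

Let V0 : 0 <= V.
Proof.
by apply: le_trans aV; rewrite addr_ge0// Rintegral_ge0// => x _; exact: sqr_ge0.
Qed.

Let kappa (s : R) := (expR (s * b) - 1) / b.

Let kappa_ge0 s : 0 <= s -> 0 <= kappa s.
Proof.
move=> s0; rewrite divr_ge0 ?(ltW b0)// subr_ge0 -expR0 ler_expR.
by rewrite mulr_ge0 ?(ltW b0).
Qed.

Let M h j := 2 ^+ j * \int[P]_x laplace_test h j (Y x).

Let iF h j : P.-integrable setT (EFin \o (fun x => laplace_test h j (Y x))).
Proof.
have F1 x : `|laplace_test h j (Y x)| <= 1.
  by rewrite (gtr0_norm (laplace_test_gt0 _ _ _)) laplace_test_le1.
exact: (integrable_bounded P (measurableT_comp (measurable_laplace_test _ _) mY) F1).
Qed.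

Let M_ge0 h j : 0 <= M h j.
Proof.
rewrite mulr_ge0 ?exprn_ge0// Rintegral_ge0// => x _.
exact/ltW/laplace_test_gt0.
Qed.

Let M_rec h j : 0 < h -> M h j.+1 * (1 - h * V * kappa (j.+1%:R * h)) <= M h j.
Proof.
move=> h0.
have st := laplace_test_stein_le mY my a0 b0 iY iy2 aV yb stein j.+1 h0.
have iYF : P.-integrable setT (EFin \o (fun x => Y x * laplace_test h j.+1 (Y x))).
  apply: integrable_mul_bounded => //.
    exact: measurableT_comp (measurable_laplace_test _ _) mY.
  by move=> x; rewrite (gtr0_norm (laplace_test_gt0 _ _ _)) laplace_test_le1.
have iC c f : P.-integrable setT (EFin \o f) -> P.-integrable setT (EFin \o (fun x => c * f x)).
  by move=> fi; rewrite /comp; under eq_fun do rewrite EFinM; exact: integrableZl.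
have step : M h j.+1 - M h j <= \int[P]_x (2 ^+ j.+1 * h * (Y x * laplace_test h j.+1 (Y x))).
  rewrite /M -!RintegralZl// -RintegralB//; [|exact: iC..].
  apply: le_Rintegral => //; [|exact: iC|].
    by rewrite /comp; under eq_fun do rewrite EFinB; apply: integrableB => //; exact: iC.
  move=> x _.
  have F0 := ltW (laplace_test_gt0 h j.+1 (Y x)).
  (* Hence [2 F_(j+1) - F_j = F_(j+1) (2 h Y - (h Y)^2)], and the square is dropped. *)
  have -> : laplace_test h j (Y x) = laplace_test h j.+1 (Y x) * (1 + (1 - h * Y x) ^+ 2).
    rewrite /laplace_test [_ ^+ j.+1]exprS invfM mulrAC mulVf ?mul1r//.
    by rewrite gt_eqF// ltr_pwDl// sqr_ge0.
  have p0 : 0 <= 2 ^+ j :> R by rewrite exprn_ge0.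
  rewrite exprS; have := mulr_ge0 (mulr_ge0 p0 F0) (sqr_ge0 (h * Y x)); lra.
rewrite RintegralZl// in step.
have p0 : 0 <= 2 ^+ j.+1 * h by rewrite mulr_ge0 ?exprn_ge0// ltW.
have := ler_wpM2l p0 st; rewrite /M in step *; rewrite /kappa; lra.
Qed.

(* A closed form dominating [h * \sum_(1 <= i < j.+1) kappa (i%:R * h)]. *)
Let S h j := (expR (h * b) * (expR (j%:R * h * b) - 1) / b - j%:R * h) / b.

(** The geometric sum of [e^(i h b)] for [1 <= i <= j] has denominator [e^(h b) - 1], which [S]
    replaces by the smaller [h b]; the gain at each step is a multiple of
    [e^(h b) - 1 - h b >= 0]. *)
Let S_rec h j : 0 < h -> S h j + h * kappa (j.+1%:R * h) <= S h j.+1.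
Proof.
move=> h0; rewrite -subr_ge0.
have -> : S h j.+1 - (S h j + h * kappa (j.+1%:R * h)) =
    expR (j.+1%:R * h * b) * (expR (h * b) - 1 - h * b) / b ^+ 2.
  rewrite /S /kappa -natr1 (_ : (j%:R + 1) * h * b = h * b + j%:R * h * b); last by ring.
  by rewrite expRD; field; rewrite gt_eqF.
rewrite divr_ge0 ?sqr_ge0// mulr_ge0 ?expR_ge0//.
by have := expR_ge1Dx (h * b); lra.
Qed.

Let M_le h (w : R) (N : nat) : 0 < h -> h * V * kappa (N%:R * h) <= w -> w < 1 ->
  forall j, (j <= N)%N -> M h j <= expR (V * S h j / (1 - w)).
Proof.
move=> h0 hw w1; elim=> [_|j ih jN].
  rewrite /M /S expr0 mul0r mul1r !mul0r expR0 subrr mulr0 mul0r subr0 mul0r mulr0.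
  rewrite mul0r expR0 -[leRHS](Rintegral_prob_cst P 1).
  apply: le_Rintegral => //; first exact: finite_measure_integrable_cst.
  by move=> x _; exact: laplace_test_le1.
have jw : h * V * kappa (j.+1%:R * h) <= w.
  apply: le_trans hw; rewrite ler_wpM2l ?mulr_ge0 ?(ltW h0)//.
  rewrite ler_wpM2r ?invr_ge0 ?(ltW b0)// lerD2r ler_expR.
  by rewrite !ler_wpM2r ?(ltW b0) ?(ltW h0)// ler_nat.
have x0 : 0 <= h * V * kappa (j.+1%:R * h).
  by apply: mulr_ge0; [rewrite mulr_ge0// ltW|apply: kappa_ge0; rewrite mulr_ge0// ltW].
have := M_rec j h0; rewrite -ler_pdivlMr; last by lra.
move=> /le_trans; apply.
apply: (@le_trans _ _ (expR (V * S h j / (1 - w)) * expR (h * V * kappa (j.+1%:R * h) / (1 - w)))).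
  apply: ler_pM => //; [by rewrite invr_ge0; lra|exact/ih/ltnW|exact: expR_mulVr_le].
rewrite -expRD ler_expR -mulrDl; apply: ler_wpM2r; first by rewrite invr_ge0; lra.
by have := ler_wpM2l V0 (S_rec j h0); rewrite mulrDr (mulrCA V h) (mulrA h V).
Qed.

(** With [h = s / (N + 1)], the bound [1 - h x + (h x)^2 / 2 <= exp (- h x + (h x)^2 / 2)] raised to
    the power [N + 1] shows that [2^(N+1) F_(N+1)] dominates [e^(s x)] damped by a Gaussian factor.
    That factor tends to 1 as [N] grows. *)
Let mgf_smooth_le (s : R) (N : nat) : 0 < s ->
  s / N.+1%:R * V * kappa s < 1 ->
  (\int[P]_x (expR (s * Y x - s * (s / N.+1%:R) * Y x ^+ 2 / 2))%:E <=
   (expR (V * ((expR (s / N.+1%:R * b) * (expR (s * b) - 1) / b - s) / b)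
     / (1 - s / N.+1%:R * V * kappa s)))%:E)%E.
Proof.
move=> s0; set h := s / N.+1%:R => w1.
have h0 : 0 < h by rewrite divr_gt0.
have Nh : N.+1%:R * h = s by rewrite /h mulrC divfK// pnatr_eq0.
have := @M_le h (h * V * kappa s) N.+1 h0; rewrite Nh => /(_ (lexx _) w1 _ (leqnn _)).
rewrite /S Nh -lee_fin; apply: le_trans.
have iG : P.-integrable setT (EFin \o (fun x => 2 ^+ N.+1 * laplace_test h N.+1 (Y x))).
  by rewrite /comp; under eq_fun do rewrite EFinM; exact: (integrableZl measurableT _ (iF _ _)).
have -> : (M h N.+1)%:E = (\int[P]_x (2 ^+ N.+1 * laplace_test h N.+1 (Y x))%:E)%E.
  rewrite -[RHS]fineK; last exact: integrable_fin_num.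
  by congr (_%:E); rewrite /M -RintegralZl.
apply: ge0_le_integral => //.
- by apply/measurable_EFinP; mfun.
- exact: measurable_int iG.
move=> x _; rewrite lee_fin /laplace_test -[2 ^+ _]invrK -invfM -exprVn -exprMn.
rewrite -[leLHS]invrK lef_pV2 ?posrE ?invr_gt0 ?expR_gt0//; last first.
  by rewrite exprn_gt0// mulr_gt0// ltr_pwDl// sqr_ge0.
have E : (expR (s * Y x - s * h * Y x ^+ 2 / 2))^-1 =
    expR (N.+1%:R * (- (h * Y x) + (h * Y x) ^+ 2 / 2)).
  by rewrite -expRN; congr expR; rewrite -Nh; ring.
rewrite E expRM_natl lerXn2r ?nnegrE ?expR_ge0//.
  by rewrite mulr_ge0 ?invr_ge0// addr_ge0// sqr_ge0.
apply: le_trans (expR_ge1Dx _); lra.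
Qed.

Lemma bennett (s : R) : 0 <= s ->
  (\int[P]_x (expR (s * Y x))%:E <=
   (expR (V * (expR (s * b) - 1 - s * b) / b ^+ 2))%:E)%E.
Proof.
rewrite le_eqVlt => /predU1P[<-|s0].
  rewrite !mul0r expR0 subrr subr0 mulr0 mul0r expR0.
  rewrite (eq_integral (fun _ => 1%:E)); last by move=> x _; rewrite mul0r expR0.
  by rewrite integral_cst//= probability_setT mule1.
(* The shift of the index by [K] makes [h n * V * kappa s < 1] hold for every [n], as [fatou_le]
   asks for a bound at each [n]. *)
pose K := Num.bound (s * V * kappa s).
have sVk0 : 0 <= s * V * kappa s by apply: mulr_ge0; [rewrite mulr_ge0// ltW|exact/kappa_ge0/ltW].
have KP : s * V * kappa s < K%:R by apply: archi_boundP.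
pose h n := s / (n + K).+1%:R.
have h0 n : 0 < h n by rewrite divr_gt0.
have hc : h n @[n --> \oo] --> 0.
  rewrite -(mulr0 s); apply: cvgMl_tmp.
  by have := @cvg_harmonic R; rewrite -(cvg_shiftn K).
apply: (@fatou_le _ _ _ P (fun n x => expR (s * Y x - s * h n * Y x ^+ 2 / 2)) _
  (fun n => expR (V * ((expR (h n * b) * (expR (s * b) - 1) / b - s) / b)
     / (1 - h n * V * kappa s)))).
- by move=> n; mfun.
- by move=> n x; exact: expR_ge0.
- move=> x; have c : s * Y x - s * h n * Y x ^+ 2 / 2 @[n --> \oo] --> s * Y x.
    rewrite -[X in _ --> X]subr0; apply: cvgB; first exact: cvg_cst.
    rewrite -(mul0r 2^-1); apply: cvgMr_tmp; rewrite -(mul0r (Y x ^+ 2)).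
    by apply: cvgMr_tmp; rewrite -(mulr0 s); exact: cvgMl_tmp.
  exact: (cvg_comp _ _ c (@continuous_expR R _)).
- move=> n; apply: mgf_smooth_le => //.
  rewrite (_ : s / _ * V * kappa s = s * V * kappa s / (n + K).+1%:R); last by ring.
  rewrite ltr_pdivrMr// mul1r.
  apply: lt_le_trans KP _; rewrite ler_nat; exact: leqW (leq_addl _ _).
have -> : V * (expR (s * b) - 1 - s * b) / b ^+ 2 =
    V * ((1 * (expR (s * b) - 1) / b - s) / b) / (1 - 0 * V * kappa s).
  by rewrite mul0r mul0r subr0; field; rewrite gt_eqF.
have c1 : expR (h n * b) @[n --> \oo] --> (1 : R).
  rewrite -expR0; have c : h n * b @[n --> \oo] --> (0 : R).
    by rewrite -(mul0r b); exact: cvgMr_tmp.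
  exact: (cvg_comp _ _ c (@continuous_expR R _)).
have c2 : V * ((expR (h n * b) * (expR (s * b) - 1) / b - s) / b)
     / (1 - h n * V * kappa s) @[n --> \oo] -->
    V * ((1 * (expR (s * b) - 1) / b - s) / b) / (1 - 0 * V * kappa s).
  apply: cvgM.
    apply: cvgMl_tmp; apply: cvgMr_tmp; apply: cvgB; last exact: cvg_cst.
    by apply: cvgMr_tmp; exact: cvgMr_tmp.
  apply: cvgV; first by rewrite !mul0r subr0 oner_neq0.
  by apply: cvgB; [exact: cvg_cst|do 2 apply: cvgMr_tmp].
exact: (cvg_comp _ _ c2 (@continuous_expR R _)).
Qed.

End bennett.

(** * Random vectors and the bounds on the radial pole *)

Lemma dotvE (R : realType) d (t x : 'rV[R]_d) : dotv t x = \sum_j t 0 j * x 0 j.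
Proof. by rewrite /dotv mxE; apply: eq_bigr => j _; rewrite mxE. Qed.

Lemma dotvDr (R : realType) d (t x z : 'rV[R]_d) :
  dotv t (x + z) = dotv t x + dotv t z.
Proof. by rewrite /dotv raddfD/= mulmxDr mxE. Qed.

Lemma dotvDl (R : realType) d (t x z : 'rV[R]_d) :
  dotv (x + z) t = dotv x t + dotv z t.
Proof. by rewrite /dotv mulmxDl mxE. Qed.

Lemma dotvZl (R : realType) d (u : R) (t x : 'rV[R]_d) :
  dotv (u *: t) x = u * dotv t x.
Proof. by rewrite /dotv -scalemxAl mxE. Qed.

Lemma dotvC (R : realType) d (t x : 'rV[R]_d) : dotv t x = dotv x t.
Proof. by rewrite !dotvE; apply: eq_bigr => j _; rewrite mulrC. Qed.

Lemma dotv_ge0 (R : realType) d (x : 'rV[R]_d) : 0 <= dotv x x.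
Proof. by rewrite dotvE sumr_ge0// => j _; rewrite -expr2 sqr_ge0. Qed.

Lemma dotv0l (R : realType) d (x : 'rV[R]_d) : dotv 0 x = 0.
Proof. by rewrite dotvE big1// => j _; rewrite mxE mul0r. Qed.

Lemma dotv_eq0 (R : realType) d (x : 'rV[R]_d) : dotv x x = 0 -> x = 0.
Proof.
rewrite dotvE => /eqP; rewrite psumr_eq0; last by move=> j _; rewrite -expr2 sqr_ge0.
move=> /allP h; apply/rowP => j; rewrite mxE; apply/eqP.
by have := h j; rewrite mem_index_enum => /(_ isT); rewrite -expr2 sqrf_eq0.
Qed.

Lemma dotv_sqr_le (R : realType) d (t x : 'rV[R]_d) :
  dotv t x ^+ 2 <= dotv t t * dotv x x.
Proof.
have [t0|t0] := eqVneq (dotv t t) 0.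
  by rewrite (dotv_eq0 t0) !dotv0l expr2 !mul0r.
have tp : 0 < dotv t t by rewrite lt_neqAle eq_sym t0 dotv_ge0.
have := dotv_ge0 (dotv t t *: x + (- dotv t x) *: t).
rewrite !(dotvDl, dotvZl, dotvDr, dotvC _ (_ *: _)) (dotvC x t) => h.
rewrite -(ler_pM2l tp); lra.
Qed.

Lemma quadZ (R : realType) d (A : 'M[R]_d) (u : R) (t : 'rV[R]_d) :
  quad A (u *: t) = u ^+ 2 * quad A t.
Proof.
rewrite /quad -!scalemxAl linearZ/= -scalemxAr !mxE; ring.
Qed.

Lemma continuous_dotv (R : realType) d (t : 'rV[R]_d) : continuous (dotv t).
Proof.
rewrite (_ : dotv t = fun x => \sum_j t 0 j * x 0 j); last first.
  by apply/funext => z; exact: dotvE.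
apply: continuous_big => [|j _ x]; [exact: add_continuous|exact: (@cvgMl_tmp R _ (nbhs x) (nbhs_filter x) _ (t 0 j) _ (@coord_continuous R 1 d 0 j x))].
Qed.

Lemma continuous_measurable_mx (R : realType) m n (f : 'M[R]_(m, n) -> R) :
  continuous f -> measurable_fun setT f.
Proof.
move=> /continuousP cf; apply: (measurability _ (RGenOpens.measurableE R)).
move=> _ [_ [a [b ->] <-]]; rewrite setTI; apply: sub_sigma_algebra.
exact/cf/interval_open.
Qed.

Lemma measurable_open_mx (R : realType) m n (U : set 'M[R]_(m, n)) :
  open U -> measurable U.
Proof. exact: sub_sigma_algebra. Qed.

Lemma measurable_dotv (R : realType) d (t : 'rV[R]_d) : measurable_fun setT (dotv t).
Proof. by apply: continuous_measurable_mx; exact: continuous_dotv. Qed.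

Lemma continuous_dotvv (R : realType) d : continuous (fun x : 'rV[R]_d => dotv x x).
Proof.
rewrite (_ : (fun x => dotv x x) = fun x => \sum_j x 0 j * x 0 j); last first.
  by apply/funext => z; exact: dotvE.
by apply: continuous_big => [|j _ x]; [exact: add_continuous|exact: (@cvgM R _ (nbhs x) (nbhs_filter x) _ _ _ _ (@coord_continuous R 1 d 0 j x) (@coord_continuous R 1 d 0 j x))].
Qed.

Lemma measurable_dotvv (R : realType) d :
  measurable_fun setT (fun x : 'rV[R]_d => dotv x x).
Proof. by apply: continuous_measurable_mx; exact: continuous_dotvv. Qed.

Lemma measurable_unit_ball (R : realType) d :
  measurable [set x : 'rV[R]_d | dotv x x <= 1].
Proof.
rewrite (_ : [set x | _] = (fun x => dotv x x) @^-1` `]-oo, 1]); last first.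
  by apply/seteqP; split => x /=; rewrite in_itv.
by rewrite -[X in measurable X]setTI; apply: (@measurable_dotvv R d).
Qed.

(** * Support and sigma-finiteness of a Lévy measure *)

Lemma null_bigcup_seq d (T : measurableType d) (R : realType)
    (mu : {measure set T -> \bar R}) (I : choiceType) (s : seq I) (f : I -> set T) :
  (forall i, i \in s -> measurable (f i) /\ mu (f i) = 0%E) ->
  measurable (\bigcup_(i in [set` s]) f i) /\ mu (\bigcup_(i in [set` s]) f i) = 0%E.
Proof.
elim: s => [|i s ih] h.
  by rewrite (_ : [set` [::]] = set0) ?bigcup_set0 ?measure0//; apply/seteqP; split.
rewrite (_ : [set` i :: s] = i |` [set` s]); last first.
  apply/seteqP; split => x /=; rewrite inE.
    by move=> /orP[/eqP|]; [left|right].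
  by move=> [->|->]; rewrite ?eqxx ?orbT.
rewrite bigcup_setU1.
have [mi i0] := h i (mem_head _ _).
have [|ms s0] := ih; first by move=> j js; apply: h; rewrite inE js orbT.
split; first exact: measurableU.
apply/eqP; rewrite eq_le measure_ge0 andbT.
rewrite (le_trans (measureU2 mu mi ms))//.
by rewrite -[leRHS]adde0; apply: leeD; [rewrite -[leRHS]i0|rewrite -[leRHS]s0]; exact: lexx.
Qed.

(** Each point of [K] has a null open neighbourhood, and finitely many of these cover [K]. *)
Lemma compact_null d (R : realType) (nu : {measure set 'rV[R]_d -> \bar R})
    (K : set 'rV[R]_d) : compact K -> measurable K ->
  K `&` msupport nu = set0 -> nu K = 0%E.
Proof.
move=> cK mK KS.
have /choice[f fP] : forall x, exists U : set 'rV[R]_d,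
    K x -> [/\ open U, U x & nu U = 0%E].
  move=> x; have [Kx|nKx] := pselect (K x); last by exists set0.
  have nS : ~ msupport nu x.
    by move=> Sx; have : (K `&` msupport nu) x by []; rewrite KS.
  move: nS => /existsNP[U /not_implyP[oU /not_implyP[Ux /negP]]].
  rewrite -leNgt => U0; exists U => _; split => //.
  by apply/eqP; rewrite eq_le U0/= measure_ge0.
move: cK; rewrite compact_cover => /(_ _ K f)[x Kx|x Kx|F FK KF].
- by have [] := fP x Kx.
- by exists x => //; have [] := fP x Kx.
have [|mF F0] := @null_bigcup_seq _ _ _ nu _ (finmap.enum_fset F) f.
  move=> i /FK; rewrite inE => Ki; have [oU _ U0] := fP i Ki; split => //.
  exact: measurable_open_mx.
by apply: subset_measure0 F0.
Qed.

Lemma jump_radius_ae d (R : realType) (nu : {measure set 'rV[R]_d -> \bar R})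
    (t : 'rV[R]_d) (b : R) : (jump_radius nu t <= b%:E)%E ->
  {ae nu, forall x, dotv t x <= b}.
Proof.
move=> tb.
(* Compact sets that miss the support and exhaust the open half-space where [dotv t x] exceeds
   [b]. *)
pose K n := [set x : 'rV[R]_d | `|x| <= n%:R /\ b + n.+1%:R^-1 <= dotv t x].
have cc c : closed [set x : 'rV[R]_d | c <= dotv t x].
  apply: (@closed_comp _ _ (dotv t) [set r | c <= r]); last exact: closed_ge.
  by move=> x _; exact: continuous_dotv.
have cN n : closed [set x : 'rV[R]_d | `|x| <= n%:R].
  apply: (@closed_comp _ _ (fun x : 'rV[R]_d => `|x|) [set r | r <= n%:R]); last exact: closed_le.
  by move=> x _; exact: norm_continuous.
have cK n : closed (K n) by exact: (closedI (cN n) (cc (b + n.+1%:R^-1))).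

have K0 n : nu (K n) = 0%E.
  apply: compact_null.
  - apply: bounded_closed_compact => //.
    exists n%:R; split; first exact: num_real.
    by move=> M nM x [xn _] /=; apply: le_trans xn (ltW nM).
  - rewrite -[K n]setCK; apply: measurableC; apply: measurable_open_mx.
    exact: closed_openC.
  - rewrite -subset0 => x [[_ bx] Sx].
    have : ((Num.max (dotv t x) 0)%:E <= b%:E)%E.
      apply: le_trans tb; apply: ereal_sup_ubound; exists x => //; by left.
    rewrite lee_fin ge_max => /andP[tx _].
    have n0 : 0 < n.+1%:R^-1 :> R by rewrite invr_gt0.
    have bx' : b + n.+1%:R^-1 <= dotv t x by [].
    by move: (le_trans bx' tx); rewrite gerDl leNgt n0.
have mK n : measurable (K n).
  by rewrite -[K n]setCK; apply: measurableC; apply: measurable_open_mx; exact: closed_openC.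
apply: (@negligibleS _ _ _ nu (\bigcup_n K n)); last first.
  apply: negligible_bigcup => n; exists (K n); split => //.
move=> x /= /negP; rewrite -ltNge => bx.
clear tb; have d0 : 0 < dotv t x - b by lra.
have [n0 _ hn0] := near_infty_natSinv_lt (PosNum d0).
pose m := Num.bound `|x|.
exists (maxn n0 m) => //; split.
  apply: (@le_trans _ _ m%:R); first by apply/ltW; apply: archi_boundP.
  by rewrite ler_nat leq_maxr.
have lt : (maxn n0 m).+1%:R^-1 < dotv t x - b := hn0 (maxn n0 m) (leq_maxl _ _).
by rewrite -lerBrDl ltW.
Qed.

Section sigma_finite_alias.
Context d (T : measurableType d) (R : realType) (nu : {measure set T -> \bar R})
  (h : sigma_finite setT nu).

(** [nu] itself under a name that carries a proof of sigma-finiteness, so that a structure can be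
    attached to it and the results relying on Fubini's theorem apply. *)
Definition sigma_finite_alias of sigma_finite setT nu : set T -> \bar R := nu.

HB.instance Definition _ := isMeasure.Build _ _ _ (sigma_finite_alias h)
  (measure0 nu) (measure_ge0 nu) (@measure_semi_sigma_additive _ _ _ nu).

HB.instance Definition _ :=
  Measure_isSigmaFinite.Build _ _ _ (sigma_finite_alias h) h.

End sigma_finite_alias.

Lemma bennett_sfinite (R : realType) d1 (T1 : measurableType d1)
    (P : probability T1 R) d2 (T2 : measurableType d2)
    (nu : {measure set T2 -> \bar R}) (Y : T1 -> R) (y : T2 -> R) (a b V : R) :
  sigma_finite setT nu ->
  measurable_fun setT Y -> measurable_fun setT y -> 0 <= a -> 0 < b ->
  P.-integrable setT (EFin \o Y) ->
  nu.-integrable setT (EFin \o (fun x => y x ^+ 2)) ->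
  a + \int[nu]_x (y x ^+ 2) <= V ->
  {ae nu, forall x, y x <= b} ->
  (forall p q,
    \int[P]_x (Y x * cos (p + q * Y x)) =
    - (q * a + levy_alpha nu y q) * \int[P]_x sin (p + q * Y x)
    + levy_beta nu y q * \int[P]_x cos (p + q * Y x)) ->
  forall s : R, 0 <= s ->
  (\int[P]_x (expR (s * Y x))%:E <=
   (expR (V * (expR (s * b) - 1 - s * b) / b ^+ 2))%:E)%E.
Proof.
move=> h mY my a0 b0 iY iy2 aV yb st.
exact: (@bennett _ _ _ P _ _ (sigma_finite_alias h) Y y a b V mY my a0 b0 iY iy2 aV yb st).
Qed.

(** Away from the origin [min (1, |x|^2)] is bounded below, so each [B n] has finite measure as in
    Markov's inequality; the origin is null. *)
Lemma levy_sigma_finite (R : realType) d (nu : {measure set 'rV[R]_d -> \bar R}) :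
  nu [set 0] = 0%E ->
  (\int[nu]_x (Num.min 1 (dotv x x))%:E < +oo)%E -> sigma_finite setT nu.
Proof.
move=> nu0 fin.
pose B n := [set x : 'rV[R]_d | n.+1%:R^-1 <= dotv x x].
have mB n : measurable (B n).
  rewrite (_ : B n = (fun x => dotv x x) @^-1` `[n.+1%:R^-1, +oo[); last first.
    by apply/seteqP; split => x /=; rewrite /B/= in_itv/= andbT.
  by rewrite -[X in measurable X]setTI; apply: (@measurable_dotvv R d) => //.
have m0 : measurable [set (0 : 'rV[R]_d)].
  rewrite (_ : [set 0] = (fun x => dotv x x) @^-1` [set (0:R)]); last first.
    by apply/seteqP; split => x /=; [move=> ->; rewrite dotv0l|exact: dotv_eq0].
  by rewrite -[X in measurable X]setTI; apply: (@measurable_dotvv R d).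
exists (fun n => [set 0] `|` B n).
  apply/esym/seteqP; split => // x _.
  have [->|x0] := eqVneq x 0; first by exists 0%N => //; left.
  have xp : 0 < dotv x x.
    rewrite lt_neqAle dotv_ge0 andbT; apply/negP => /eqP h.
    by move/eqP: x0; apply; exact/dotv_eq0.
  have [n0 _ hn0] := near_infty_natSinv_lt (PosNum xp).
  by exists n0 => //; right; apply/ltW/(hn0 n0) => /=.
move=> n; split; first exact: measurableU.
apply: (le_lt_trans (measureU2 nu m0 (mB n))).
apply: lte_add_pinfty; first by change (nu [set 0%R] < +oo)%E; rewrite nu0.
change (nu (B n) < +oo)%E.
have e0 : 0 < n.+1%:R^-1 :> R by rewrite invr_gt0.
have : ((n.+1%:R^-1)%:E * nu (B n) < +oo)%E.
  apply: le_lt_trans fin.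
  rewrite -integral_cst//=.
  apply: (@le_trans _ _ (\int[nu]_(x in B n) (Num.min 1 (dotv x x))%:E)%E).
    apply: ge0_le_integral => //.
    - apply/measurable_EFinP/measurable_funTS/measurable_minr => //.
      exact: measurable_dotvv.
    - move=> x; rewrite /B/= lee_fin le_min => ->; rewrite andbT.
      by rewrite invf_le1// ler1n.
  apply: ge0_subset_integral => //.
    apply/measurable_EFinP/measurable_minr => //.
    exact: measurable_dotvv.
  by move=> x _; rewrite lee_fin le_min ler01 dotv_ge0.
have := measure_ge0 nu (B n).
case: (nu (B n)) => [r _ _|_|//]; first exact: ltry.
by rewrite gt0_muley ?lte_fin.
Qed.

(** * Moments of one-dimensional projections *)

Section random_vector_projection.
Context (R : realType) (d : nat) disp (Omega : measurableType disp)
  (P : probability Omega R) (X : {RV P >-> 'rV[R]_d}).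
Hypotheses (cX : centered X) (sX : finite_second_moment X).

Lemma measurable_proj t : measurable_fun setT (fun w => dotv t (X w)).
Proof. exact: (measurableT_comp (measurable_dotv t)). Qed.

Let mcoord j : measurable_fun setT (fun w => X w 0 j).
Proof.
apply: (measurableT_comp (f := fun x : 'rV[R]_d => x 0 j)) => //.
by apply: continuous_measurable_mx; exact: coord_continuous.
Qed.

Let isqr : P.-integrable setT (EFin \o (fun w => dotv (X w) (X w))).
Proof.
apply/integrableP; split.
  by apply/measurable_EFinP; apply: (measurableT_comp (@measurable_dotvv R d)).
move: sX; rewrite /finite_second_moment unlock; apply: le_lt_trans.
rewrite le_eqVlt; apply/orP; left; apply/eqP; apply: eq_integral => w _ /=.
by rewrite ger0_norm ?dotv_ge0.
Qed.

Let coord_le (x : 'rV[R]_d) i : x 0 i ^+ 2 <= dotv x x.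
Proof.
rewrite dotvE (bigD1 i)//= -expr2 lerDl sumr_ge0// => j _.
by rewrite -expr2 sqr_ge0.
Qed.

Let icc i j : P.-integrable setT (EFin \o (fun w => X w 0 i * X w 0 j)).
Proof.
apply: (integrable_dominated _ isqr); first exact: measurable_funM.
move=> w; have := coord_le (X w) i; have := coord_le (X w) j.
rewrite ler_norml; have := sqr_ge0 (X w 0 i + X w 0 j).
by have := sqr_ge0 (X w 0 i - X w 0 j); lra.
Qed.

Let ic i : P.-integrable setT (EFin \o (fun w => X w 0 i)).
Proof.
apply: (@integrable_dominated _ _ _ _ _ (fun w => 1 + dotv (X w) (X w))) => //.
  rewrite /comp; under eq_fun do rewrite EFinD.
  by apply: integrableD => //; exact: finite_measure_integrable_cst.
move=> w; have := coord_le (X w) i; rewrite ler_norml.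
by have := sqr_ge0 (X w 0 i + 1); have := sqr_ge0 (X w 0 i - 1); lra.
Qed.

Let Rint_sum (I : Type) (s : seq I) (f : I -> Omega -> R) :
  (forall i, P.-integrable setT (EFin \o f i)) ->
  P.-integrable setT (EFin \o (fun w => \sum_(i <- s) f i w)) /\
  \int[P]_w (\sum_(i <- s) f i w) = \sum_(i <- s) \int[P]_w f i w.
Proof.
move=> fi; elim: s => [|i s [ih1 ih2]].
  rewrite big_nil; split.
    by under eq_fun do rewrite big_nil; exact: finite_measure_integrable_cst.
  by under eq_Rintegral do rewrite big_nil; exact: Rintegral_prob_cst.
rewrite big_cons; split.
  under eq_fun do rewrite big_cons.
  by rewrite /comp; under eq_fun do rewrite EFinD; exact: (integrableD measurableT (fi i) ih1).
by under eq_Rintegral do rewrite big_cons; rewrite RintegralD// ih2.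
Qed.

Let iZ c (f : Omega -> R) : P.-integrable setT (EFin \o f) ->
  P.-integrable setT (EFin \o (fun x => c * f x)).
Proof. by move=> fi; rewrite /comp; under eq_fun do rewrite EFinM; exact: integrableZl. Qed.

Lemma integrable_proj t : P.-integrable setT (EFin \o (fun w => dotv t (X w))).
Proof.
rewrite /comp; under eq_fun do rewrite dotvE.
by apply: (Rint_sum _ _).1 => i; exact: iZ.
Qed.

Lemma Rintegral_proj t : \int[P]_w dotv t (X w) = 0.
Proof.
under eq_Rintegral do rewrite dotvE.
rewrite (Rint_sum _ _).2; last by move=> i; exact: iZ.
rewrite big1// => i _; rewrite RintegralZl//.
rewrite (_ : \int[P]_w X w 0 i = 0) ?mulr0//.
by have := cX i; rewrite unlock /Rintegral => ->.
Qed.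

Let proj_sqrE t (w : Omega) : dotv t (X w) ^+ 2 =
  \sum_j \sum_i (t 0 i * t 0 j) * (X w 0 i * X w 0 j).
Proof.
rewrite dotvE expr2 mulr_sumr; apply: eq_bigr => j _.
by rewrite mulr_suml; apply: eq_bigr => i _; ring.
Qed.

Lemma integrable_proj_sqr t :
  P.-integrable setT (EFin \o (fun w => dotv t (X w) ^+ 2)).
Proof.
rewrite /comp; under eq_fun do rewrite proj_sqrE.
by apply: (Rint_sum _ _).1 => j; apply: (Rint_sum _ _).1 => i; exact: iZ.
Qed.

Lemma variance_formE t : variance_form X t = \int[P]_w (dotv t (X w) ^+ 2).
Proof.
under eq_Rintegral do rewrite proj_sqrE.
rewrite (Rint_sum _ _).2; last first.
  by move=> j; apply: (Rint_sum _ _).1 => i; exact: iZ.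
rewrite /variance_form /quad mxE; apply: eq_bigr => j _.
rewrite (Rint_sum _ _).2; last by move=> i; exact: iZ.
rewrite !mxE mulr_suml; apply: eq_bigr => i _.
rewrite RintegralZl// /covmx !mxE.
suff -> : fine (covariance P (fun w => X w 0 i) (fun w => X w 0 j)) =
    \int[P]_w (X w 0 i * X w 0 j) by ring.
rewrite unlock !cX /= unlock; congr fine; apply: eq_integral => w _.
by rewrite /= /GRing.mul/= !subr0.
Qed.

End random_vector_projection.

Section radial_pole_bounds.
Context (R : realType) (d : nat) disp (Omega : measurableType disp)
  (P : probability Omega R) (X : {RV P >-> 'rV[R]_d}).

Lemma log_mgfE t (s : R) :
  log_mgf X (s *: t) = lne (\int[P]_w (expR (s * dotv t (X w)))%:E)%E.
Proof.
rewrite /log_mgf unlock; congr lne; apply: eq_integral => w _.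
by rewrite dotvZl.
Qed.

Lemma log_mgf_le t (s M : R) :
  (\int[P]_w (expR (s * dotv t (X w)))%:E <= (expR M)%:E)%E ->
  (log_mgf X (s *: t) <= M%:E)%E.
Proof.
rewrite log_mgfE => h; rewrite -[leRHS](expeRK M%:E).
rewrite lee_lne// ?in_itv/= ?leey ?andbT ?lee_fin ?expR_ge0//.
by apply: integral_ge0 => w _; rewrite lee_fin expR_ge0.
Qed.

Lemma eff_domainP t :
  eff_domain X t <-> (\int[P]_w (expR (dotv t (X w)))%:E < +oo)%E.
Proof.
rewrite /eff_domain /= /log_mgf unlock; split.
  by case: (integral _ _ _) => [r _||] //; exact: ltry.
by case: (integral _ _ _) => [r _||] //=; case: ifP => // _; exact: ltry.
Qed.

Hypotheses (cX : centered X) (sX : finite_second_moment X).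

Lemma variance_form_ge0 t : 0 <= variance_form X t.
Proof. by rewrite (variance_formE cX sX) Rintegral_ge0// => w _; exact: sqr_ge0. Qed.

(** * Upper bound on the radial pole *)

Section upper.
Variable nu : {measure set 'rV[R]_d -> \bar R}.
Hypothesis levy : levy_measure (distribution P X) nu.

(** Restricting the Lévy-Khintchine formula to the line spanned by [t] gives the scalar setting with
    [y = dotv t], Gaussian variance [quad A t], and [D] the unit ball. *)
Lemma mgf_bennett t (b : R) : 0 < b -> (jump_radius nu t <= b%:E)%E ->
  forall s : R, 0 <= s ->
  (\int[P]_w (expR (s * dotv t (X w)))%:E <=
   (expR (variance_form X t * (expR (s * b) - 1 - s * b) / b ^+ 2))%:E)%E.
Proof.
move=> b0 jb; have [nu0 fin [g [A [_ A0 charE]]]] := levy.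
pose D := [set x : 'rV[R]_d | dotv x x <= 1].
have mD : measurable D by exact: measurable_unit_ball.
have mmin : measurable_fun setT (fun x : 'rV[R]_d => (Num.min 1 (dotv x x))%:E).
  by apply/measurable_EFinP/measurable_minr => //; exact: measurable_dotvv.
have min0 (x : 'rV[R]_d) : (0 <= (Num.min 1 (dotv x x))%:E)%E.
  by rewrite lee_fin le_min ler01 dotv_ge0.
have nuD : (nu (~` D) < +oo)%E.
  apply: le_lt_trans fin.
  have mDC : measurable (~` D) by exact: measurableC.
  rewrite -[leLHS]mul1e -integral_cst//.
  apply: (@le_trans _ _ (\int[nu]_(x in ~` D) (Num.min 1 (dotv x x))%:E)%E).
    apply: ge0_le_integral => //; first exact: measurable_funTS.
    by move=> x /= /negP; rewrite -ltNge => x1; rewrite lee_fin le_min lexx ltW.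
  exact: ge0_subset_integral.
have my := measurable_dotv t.
(* Cauchy-Schwarz: on the unit ball the squared projection is at most [dotv t t] times the
   integrable weight of the Lévy condition. *)
have iyD : (\int[nu]_(x in D) (dotv t x ^+ 2)%:E < +oo)%E.
  apply: (@le_lt_trans _ _ (\int[nu]_(x in D) ((dotv t t)%:E * (Num.min 1 (dotv x x))%:E))%E).
    apply: ge0_le_integral => //.
    - by move=> x _; rewrite lee_fin sqr_ge0.
    - by apply/measurable_EFinP/measurable_funTS; mfun.
    - by apply/measurable_funTS; exact: measurable_funeM.
    - move=> x Dx; rewrite -EFinM lee_fin (min_r Dx); exact: dotv_sqr_le.
  rewrite ge0_integralZl//; [|exact: measurable_funTS|exact: dotv_ge0].
  apply: lte_mul_pinfty => //; first by rewrite lee_fin dotv_ge0.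
  by apply: le_lt_trans fin; exact: ge0_subset_integral.
have mY := measurable_proj X t.
have cosE u : \int[distribution P X]_x cos (u * dotv t x) = \int[P]_w cos (u * dotv t (X w)).
  rewrite /Rintegral integral_distribution//.
    by apply/measurable_EFinP; mfun.
  by apply: (@integrable_bounded _ _ _ P (fun w => cos (u * dotv t (X w))) 1);
    [mfun|move=> x; exact: cos_max].
have sinE u : \int[distribution P X]_x sin (u * dotv t x) = \int[P]_w sin (u * dotv t (X w)).
  rewrite /Rintegral integral_distribution//.
    by apply/measurable_EFinP; mfun.
  by apply: (@integrable_bounded _ _ _ P (fun w => sin (u * dotv t (X w))) 1);
    [mfun|move=> x; exact: sin_max].
have reE u : - quad A (u *: t) / 2 + \int[nu]_x (cos (dotv (u *: t) x) - 1) =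
    levy_re nu (dotv t) (quad A t) u.
  rewrite quadZ /levy_re; under eq_Rintegral do rewrite dotvZl.
  by [].
have imE u : dotv (u *: t) g + \int[nu]_x (sin (dotv (u *: t) x)
      - dotv (u *: t) x * \1_[set x | dotv x x <= 1] x) =
    levy_im nu (dotv t) (dotv t g) D u.
  rewrite dotvZl /levy_im; under eq_Rintegral do rewrite dotvZl.
  by [].
have LK u : \int[distribution P X]_x cos (dotv (u *: t) x) =
      expR (levy_re nu (dotv t) (quad A t) u) * cos (levy_im nu (dotv t) (dotv t g) D u)
    /\ \int[distribution P X]_x sin (dotv (u *: t) x) =
      expR (levy_re nu (dotv t) (quad A t) u) * sin (levy_im nu (dotv t) (dotv t g) D u).
  by rewrite -reE -imE; case: (charE (u *: t)).
have LKc u : \int[P]_w cos (u * dotv t (X w)) =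
    expR (levy_re nu (dotv t) (quad A t) u) * cos (levy_im nu (dotv t) (dotv t g) D u).
  have [h _] := LK u; rewrite -[RHS]h -cosE.
  by apply: eq_Rintegral => x _; rewrite dotvZl.
have LKs u : \int[P]_w sin (u * dotv t (X w)) =
    expR (levy_re nu (dotv t) (quad A t) u) * sin (levy_im nu (dotv t) (dotv t g) D u).
  have [_ h] := LK u; rewrite -[RHS]h -sinE.
  by apply: eq_Rintegral => x _; rewrite dotvZl.
have iY2 := integrable_proj_sqr sX t.
have EY0 := Rintegral_proj cX sX t.
have iy2 := levy_integrable_sqr mY my mD iY2 nuD iyD LKc LKs.
have m2 := levy_second_moment_le mY my mD iY2 nuD iyD LKc LKs.
have st := levy_stein mY my mD iY2 EY0 nuD iyD LKc LKs.
apply: (bennett_sfinite (levy_sigma_finite nu0 fin) mY my (A0 t) b0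
  (integrable_proj sX t) iy2 _ (jump_radius_ae jb) st).
rewrite (variance_formE cX sX) -lerBrDl -lee_fin; apply: le_trans m2.
by rewrite fineK//; exact: integrable_fin_num.
Qed.

Lemma pole_bound_jump_radius t (b : R) : 0 < b -> (jump_radius nu t <= b%:E)%E ->
  pole_bound X t (b / 3).
Proof.
move=> b0 jb s s0; rewrite inver gt_eqF ?divr_gt0// lte_fin invf_div => sb.
apply: log_mgf_le; apply: le_trans (mgf_bennett b0 jb s0) _.
rewrite lee_fin ler_expR.
have sb3 : s * b < 3 by rewrite -ltr_pdivlMr.
have sb0 : 0 <= s * b by rewrite mulr_ge0 ?(ltW b0).
have := expR_sub1_le sb0 sb3 => h.
have V0 := variance_form_ge0 t.
have k0 : 0 < 1 - s * b / 3 by lra.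
rewrite ler_pdivrMr ?exprn_gt0// (_ : _ / _ * b ^+ 2 =
  variance_form X t * ((s * b) ^+ 2 / (2 * (1 - s * b / 3)))); last first.
  rewrite (_ : 1 - b / 3 * s = 1 - s * b / 3); last by ring.
  by rewrite exprMn; ring.
exact: ler_wpM2l.
Qed.

Lemma radial_pole_le_jump_radius t :
  (radial_pole X t <= jump_radius nu t / 3%:E)%E.
Proof.
have j0 : (0 <= jump_radius nu t)%E.
  apply: ereal_sup_ubound; exists 0; first by right.
  by rewrite /dotv trmx0 mulmx0 mxE maxxx.
rewrite inver pnatr_eq0/=.
rewrite /radial_pole; case: ifPn => V0; last by rewrite mule_ge0// lee_fin invr_ge0.
have [->|jy] := eqVneq (jump_radius nu t) +oo%E.
  by rewrite gt0_mulye ?leey// lte_fin invr_gt0.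
case E : (jump_radius nu t) j0 jy => [b| |] // b0 _.
(* The jump radius may be 0, so the pole bound is applied to the positive number [b + 3 e], which
   costs [e] in the pole. *)
apply/lee_addgt0Pr => e e0; rewrite -EFinM -EFinD.
have b3 : 0 < b + 3 * e by rewrite lee_fin in b0; lra.
apply: ereal_inf_lbound; exists ((b + 3 * e) / 3).
  split; first by rewrite divr_ge0// ltW.
  by apply: pole_bound_jump_radius => //; rewrite E lee_fin; lra.
by congr (_%:E); field.
Qed.

End upper.

(** * Lower bound on the radial pole *)

Section lower.
Hypothesis dom0 : mgf_domain X 0.

Let mE (t : 'rV[R]_d) : measurable_fun setT (fun w => (expR (dotv t (X w)))%:E).
Proof. by apply/measurable_EFinP; have := measurable_proj X t; mfun. Qed.

Lemma eff_domain_conv t u (l : R) : 0 <= l <= 1 ->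
  eff_domain X t -> eff_domain X u -> eff_domain X (l *: t + (1 - l) *: u).
Proof.
move=> /andP[l0 l1] /eff_domainP ht /eff_domainP hu; apply/eff_domainP.
have l1' : 0 <= 1 - l by rewrite subr_ge0.
apply: (@le_lt_trans _ _ (\int[P]_w (l%:E * (expR (dotv t (X w)))%:E
    + (1 - l)%:E * (expR (dotv u (X w)))%:E))%E).
  apply: ge0_le_integral => //.
  - by apply: emeasurable_funD; exact: measurable_funeM.
  move=> w _; rewrite -!EFinM -EFinD lee_fin dotvDl !dotvZl.
  have ls : Itv.spec (@Itv.num_sem R) (Itv.Real `[0%Z, 1%Z]) l.
    by rewrite /= /Itv.num_sem/= in_itv/= l0 l1 ger0_real.
  exact: (@convex_expR R (Itv.mk ls) (dotv t (X w)) (dotv u (X w))).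
rewrite ge0_integralD//.
- rewrite !ge0_integralZl//; try by move=> w _; rewrite lee_fin expR_ge0.
  by rewrite lte_add_pinfty// lte_mul_pinfty.
- by move=> w _; rewrite mule_ge0// lee_fin expR_ge0.
- exact: measurable_funeM.
- by move=> w _; rewrite mule_ge0// lee_fin expR_ge0.
- exact: measurable_funeM.
Qed.

(** If the ball of radius [e] about 0 lies in the domain, the ball of radius [(1 - l) e] about
    [l *: t] consists of combinations of [t] with points of the former, hence lies in the domain by
    convexity. *)
Lemma mgf_domain_scale t (l : R) : 0 <= l -> l < 1 -> eff_domain X t ->
  mgf_domain X (l *: t).
Proof.
move=> l0 l1 tE; move: dom0; rewrite /mgf_domain /interior/= => /nbhs_ballP[e /= e0 he].
have l1' : 0 < 1 - l by lra.
apply/nbhs_ballP; exists ((1 - l) * e) => /=; first exact: mulr_gt0.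
move=> z; rewrite -ball_normE/= => zb.
pose u := (1 - l)^-1 *: (z - l *: t).
have -> : z = l *: t + (1 - l) *: u.
  by rewrite /u scalerA divff ?gt_eqF// scale1r addrC subrK.
apply: eff_domain_conv => //; first by rewrite l0 ltW.
apply: he; rewrite -ball_normE/= sub0r normrN /u normrZ gtr0_norm ?invr_gt0//.
by rewrite ltr_pdivrMl// -normrN opprB.
Qed.

Lemma minkowski_le t (s : R) : 0 < s ->
  (forall r : R, 0 <= r -> r < s -> eff_domain X (r *: t)) ->
  (minkowski_functional (mgf_domain X) t <= (s^-1)%:E)%E.
Proof.
move=> s0 h; apply/lee_addgt0Pr => e e0; rewrite -EFinD.
pose c := s^-1 + e.
have c0 : 0 < c by rewrite addr_gt0 ?invr_gt0.
have cs : c^-1 < s by rewrite invf_plt ?posrE// ltrDl.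
(* A point strictly between [c^-1] and [s]: [r *: t] is still in the domain, and [c^-1 *: t] is a
   contraction of it by a factor below 1, hence interior. *)
pose r := (c^-1 + s) / 2.
have [r0 rs] : 0 < r /\ r < s.
  have c'0 : 0 < c^-1 by rewrite invr_gt0.
  by rewrite /r; split; lra.
apply: ereal_inf_lbound; exists c => //; split => //.
exists (c^-1 *: t); last by rewrite /= scalerA divff ?gt_eqF// scale1r.
rewrite (_ : c^-1 *: t = (c^-1 / r) *: (r *: t)); last first.
  by rewrite scalerA divfK ?gt_eqF.
apply: mgf_domain_scale.
- by rewrite divr_ge0 ?invr_ge0 ?ltW.
- by rewrite ltr_pdivrMr// mul1r /r; lra.
- by apply: h => //; exact: ltW.
Qed.

Lemma minkowski_le_radial_pole t :
  (minkowski_functional (mgf_domain X) t <= radial_pole X t)%E.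
Proof.
have mink0 : (forall r : R, 0 <= r -> eff_domain X (r *: t)) ->
    (minkowski_functional (mgf_domain X) t <= 0)%E.
  move=> h; apply/lee_addgt0Pr => e e0; rewrite add0e -[e]invrK.
  by apply: minkowski_le => [|r r0 _]; [rewrite invr_gt0|exact: h].
rewrite /radial_pole; case: ifPn => V0.
  apply: le_ereal_inf_tmp => _ [c [c0 pc] <-].
  have fin (r : R) : 0 <= r -> (r%:E < c%:E^-1)%E -> eff_domain X (r *: t).
    by move=> r0 rc; exact: le_lt_trans (pc r r0 rc) (ltry _).
  have [cE|cN] := eqVneq c 0.
    by rewrite cE; apply: mink0 => r r0; apply: fin; rewrite ?cE ?inve0 ?ltry.
  have {}c0 : 0 < c by rewrite lt_neqAle eq_sym cN.
  rewrite -[c]invrK; apply: minkowski_le; first by rewrite invr_gt0.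
  by move=> r r0 rc; apply: fin => //; rewrite inver gt_eqF.
(* When the variance vanishes, [dotv t (X w)] is almost surely 0, so the moment generating function
   equals 1 on the whole line spanned by [t]. *)
apply: mink0 => r _; apply/eff_domainP.
have V00 : \int[P]_w (dotv t (X w) ^+ 2) = 0.
  apply/eqP; rewrite eq_le -(variance_formE cX sX) variance_form_ge0 andbT.
  by rewrite leNgt.
have iY2 := integrable_proj_sqr sX t.
have : (\int[P]_w `|(dotv t (X w) ^+ 2)%:E| = 0)%E.
  transitivity (\int[P]_w (dotv t (X w) ^+ 2)%:E)%E.
    by apply: eq_integral => w _ /=; rewrite ger0_norm ?sqr_ge0.
  rewrite -[LHS]fineK; last exact: (integrable_fin_num _ iY2).
  by congr (_%:E).
move/(ae_eq_integral_abs P measurableT (measurable_int _ iY2)) => ae0.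
rewrite (ae_eq_integral (cst 1%:E)) //.
- by rewrite integral_cst//= probability_setT mule1 ltry.
- by apply: filterS ae0 => w /(_ I) /eqP; rewrite eqe sqrf_eq0 => /eqP h _;
    rewrite dotvZl h mulr0 expR0.
Qed.

End lower.

End radial_pole_bounds.

(** * The centred Poisson law *)

(** Unordered summation of nonnegative terms allows reindexing the pairs [(k, j)] by [(k + j, k)].
    The factor [g] at [k + j] carries the indicator of a set evaluated at a sum of Poisson
    values. *)
Lemma nneseries_cauchy_product (R : realType) (a b : nat -> R) (g : nat -> \bar R) :
  (forall k, 0 <= a k) -> (forall k, 0 <= b k) -> (forall k, 0 <= g k)%E ->
  (\sum_(0 <= k <oo) ((a k)%:E * \sum_(0 <= j <oo) ((b j)%:E * g (k + j)%N)) =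
   \sum_(0 <= i <oo) ((\sum_(k < i.+1) a k * b (i - k)%N)%:E * g i))%E.
Proof.
move=> a0 b0 g0.
have ag k j : (0 <= (b j)%:E * g (k + j)%N)%E by rewrite mule_ge0// lee_fin.
have abg k j : (0 <= (a k)%:E * ((b j)%:E * g (k + j)%N))%E by rewrite mule_ge0// lee_fin.
pose J (i : nat) : set nat := `I_i.+1.
pose h (i k : nat) : \bar R := ((a k * b (i - k)%N)%:E * g i)%E.
have h0 i k : (0 <= h i k)%E by rewrite mule_ge0// lee_fin mulr_ge0.
transitivity (\esum_(k in [set: nat]) \esum_(j in [set: nat])
    ((a k)%:E * ((b j)%:E * g (k + j)%N)))%E.
  rewrite nneseries_esumT; last by move=> k; rewrite mule_ge0 ?lee_fin// nneseries_ge0.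
  apply: eq_esum => k _.
  by rewrite -nneseries_esumT// nneseriesZl.
rewrite esum_esum//.
transitivity (\esum_(i in [set: nat]) \esum_(k in J i) h i k)%E; last first.
  rewrite nneseries_esumT; last first.
    by move=> i; rewrite mule_ge0// lee_fin sumr_ge0// => k _; rewrite mulr_ge0.
  apply: eq_esum => i _; rewrite esum_fset//; last exact: finite_II.
  rewrite -fsbig_ord /h -sumEFin ge0_sume_distrl// => k _.
  by rewrite lee_fin mulr_ge0.
rewrite esum_esum//.
rewrite (@reindex_esum _ _ _ ([set: nat] `*`` (fun=> [set: nat])) ([set: nat] `*`` J)
  (fun z : nat * nat => ((z.1 + z.2)%N, z.1))).
  apply: eq_esum => -[k j] _ /=; rewrite /h addKn.
  by rewrite muleA EFinM.
split.
- by move=> [k j] _ /=; split => //=; rewrite /J/= ltnS leq_addr.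
- by move=> [k j] [k' j'] _ _ /= [+ kk]; rewrite kk => /addnI ->.
- move=> [i k] [_ /=]; rewrite /J/= ltnS => ki.
  by exists (k, (i - k)%N) => //=; rewrite subnKC.
Qed.

Definition poisson_weight (R : realType) (r : R) (k : nat) : R :=
  r ^+ k / k`!%:R * expR (- r).

Lemma poisson_weight_ge0 (R : realType) (r : R) k : 0 <= r -> 0 <= poisson_weight r k.
Proof. by move=> r0; rewrite !mulr_ge0 ?exprn_ge0 ?expR_ge0// invr_ge0. Qed.

Lemma poisson_weight_conv (R : realType) (r s : R) i :
  \sum_(k < i.+1) poisson_weight r k * poisson_weight s (i - k) =
  poisson_weight (r + s) i.
Proof.
rewrite /poisson_weight opprD expRD addrC exprDn !mulr_suml.
apply: eq_bigr => k _; have ki : (k <= i)%N by rewrite -ltnS.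
have f0 n : n`!%:R != 0 :> R by rewrite pnatr_eq0 -lt0n fact_gt0.
rewrite -[_ *+ 'C(i, k)]mulr_natr.
have -> : 'C(i, k)%:R = i`!%:R / (k`!%:R * (i - k)`!%:R) :> R.
  by rewrite -(bin_fact ki) !natrM; field; rewrite !f0.
by field; rewrite !f0.
Qed.

Lemma ge0_integral_poisson (R : realType) (r : R) (f : nat -> \bar R) : 0 < r ->
  (forall k, 0 <= f k)%E ->
  (\int[poisson_prob r 0]_k f k =
   \sum_(0 <= k <oo) ((poisson_weight r k)%:E * f k))%E.
Proof.
move=> r0 f0.
have w0 k : 0 <= poisson_weight r k by exact/poisson_weight_ge0/ltW.
pose m k := mscale (NngNum (w0 k)) (@dirac _ nat k R).
rewrite (eq_measure_integral (mseries m 0)); last first.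
  move=> A mA _ /=; rewrite /mseries /poisson_prob r0.
  rewrite nneseries_esumT; last by move=> k; rewrite measure_ge0.
  rewrite esum_mkcond; apply: eq_esum => k _.
  rewrite /m/= /mscale/= diracE /poisson_weight /poisson_pmf r0.
  by case: ifPn => kA; rewrite ?mule1 ?mule0.
rewrite ge0_integral_measure_series//.
apply: eq_eseriesr => k _; rewrite ge0_integral_mscale//.
by rewrite integral_dirac// diracT mul1e.
Qed.

Lemma poisson_weight_sum (R : realType) (r : R) : 0 < r ->
  (\sum_(0 <= k <oo) (poisson_weight r k)%:E = 1%E)%E.
Proof.
move=> r0; have := ge0_integral_poisson (f := fun=> 1%E) r0 (fun=> lee01).
rewrite integral_cst//= probability_setT mule1 => ->.
by apply: eq_eseriesr => k _; rewrite mule1.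
Qed.

(** The Chen-Stein identity of the Poisson law: [k] times the weight at [k] is [r] times the weight
    at [k - 1]. *)
Lemma ge0_poisson_stein (R : realType) (r : R) (f : nat -> R) : 0 < r ->
  (forall k, 0 <= f k) ->
  (\int[poisson_prob r 0]_k (k%:R * f k)%:E =
   r%:E * \int[poisson_prob r 0]_k (f k.+1)%:E)%E.
Proof.
move=> r0 f0.
have w0 k : 0 <= poisson_weight r k by exact/poisson_weight_ge0/ltW.
rewrite !ge0_integral_poisson//; last 2 first.
- by move=> k; rewrite lee_fin.
- by move=> k; rewrite lee_fin mulr_ge0.
rewrite nneseries_recl//; last by move=> k _; rewrite mule_ge0// lee_fin// mulr_ge0.
rewrite mul0r mule0 add0e -nneseriesZl; last by move=> k _; rewrite mule_ge0// lee_fin.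
rewrite -(nneseries_addn 1); last by move=> k; rewrite mule_ge0// lee_fin// mulr_ge0.
apply: eq_eseriesr => k _; rewrite addn1 -!EFinM; congr (_%:E).
rewrite /poisson_weight factS exprS natrM; field.
by rewrite nat1r !pnatr_eq0 -lt0n fact_gt0.
Qed.

Lemma continuous_measurable_mx_mx (R : realType) m n p q
    (f : 'M[R]_(m, n) -> 'M[R]_(p, q)) : continuous f -> measurable_fun setT f.
Proof.
move=> /continuousP cf; apply: (measurability (@open 'M[R]_(p, q))) => //.
move=> _ [B oB <-]; rewrite setTI; apply: sub_sigma_algebra; exact: cf.
Qed.

Lemma measurable_addmx (R : realType) m n (x : 'M[R]_(m, n)) :
  measurable_fun setT (fun z : 'M[R]_(m, n) => z + x).
Proof.
apply: continuous_measurable_mx_mx => z.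
by apply: (@cvgD _ _ _ (nbhs z) (nbhs_filter z)); [exact: cvg_id|exact: cvg_cst].
Qed.

Lemma measurable_nat_fun d (T : measurableType d) (f : nat -> T) : measurable_fun setT f.
Proof. by []. Qed.

Section poisson_vector.
Context (R : realType) (d : nat) (v : 'rV[R]_d).

Definition poisson_vec (r : R) (k : nat) : 'rV[R]_d := (k%:R - r) *: v.

HB.instance Definition _ r := isMeasurableFun.Build _ _ _ _ (poisson_vec r)
  (measurable_nat_fun (poisson_vec r)).

Definition poisson_law r : probability 'rV[R]_d R :=
  distribution (poisson_prob r 0) (poisson_vec r).

Lemma poisson_lawE r A : 0 < r -> measurable A ->
  (poisson_law r A =
   \sum_(0 <= k <oo) ((poisson_weight r k)%:E * (\1_A (poisson_vec r k))%:E))%E.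
Proof.
move=> r0 mA; rewrite -ge0_integral_poisson//.
by rewrite -[RHS]/(\int[poisson_prob r 0]_k (\1_(poisson_vec r @^-1` A) k)%:E)%E
  integral_indic ?setIT.
Qed.

(** Rates add under convolution. The series form also covers [m = 0], that is rate 0, where
    [poisson_lawE] does not apply. *)
Lemma conv_pow_poisson_law (r : R) m A : 0 < r -> measurable A ->
  (conv_pow (poisson_law r) m A =
   \sum_(0 <= k <oo) ((poisson_weight (m%:R * r) k)%:E
      * (\1_A (poisson_vec (m%:R * r) k))%:E))%E.
Proof.
move=> r0; elim: m A => [|m ih] A mA /=.
  (* At rate 0 only the term [k = 0] survives, since [0 ^+ 0 = 1], and it is the Dirac mass at the
     origin. *)
  rewrite nneseries_recl//; last first.
    by move=> k _; rewrite mule_ge0// lee_fin poisson_weight_ge0// mul0r.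
  rewrite eseries0 ?adde0; last first.
    move=> [//|k] _ _; rewrite /poisson_weight mul0r exprS !mul0r.
    by rewrite mul0e.
  rewrite /poisson_weight /poisson_vec mul0r expr0 oppr0 expR0 fact0 invr1 !mulr1.
  by rewrite mul1e addr0 scale0r diracE indicE.
have mAx x : measurable [set y : 'rV[R]_d | A (x + y)].
  rewrite (_ : [set y | A (x + y)] = (fun y => y + x) @^-1` A); last first.
    by apply/seteqP; split => y /=; rewrite addrC.
  by rewrite -[X in measurable X]setTI; exact: measurable_addmx.
have w0 s k : 0 <= s -> (0 <= (poisson_weight s k)%:E)%E.
  by move=> s0; rewrite lee_fin poisson_weight_ge0.
have mr : 0 <= m%:R * r by rewrite mulr_ge0// ltW.
have i0 (x : 'rV[R]_d) : (0 <= (\1_A x : R)%:E)%E by rewrite lee_fin.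
under eq_integral do rewrite ih//.
rewrite ge0_integral_distribution; last 2 first.
- apply: ge0_emeasurable_sum => [k x _ _|k _]; first by rewrite mule_ge0 ?w0.
  apply: measurable_funeM; apply/measurable_EFinP.
  apply: (@measurableT_comp _ _ _ _ _ _ (\1_A : 'rV[R]_d -> R)); first exact: measurable_indic.
  exact: measurable_addmx.
- by move=> x; apply: nneseries_ge0 => k _; rewrite mule_ge0 ?w0// lee_fin.
rewrite ge0_integral_poisson//; last first.
  by move=> k; apply: nneseries_ge0 => j _; rewrite mule_ge0 ?w0// lee_fin.
transitivity (\sum_(0 <= k <oo) ((poisson_weight r k)%:E * \sum_(0 <= j <oo)
    ((poisson_weight (m%:R * r) j)%:E * (\1_A (poisson_vec (m.+1%:R * r) (k + j)))%:E)))%E.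
  apply: eq_eseriesr => k _; congr (_ * _)%E.
  apply: eq_eseriesr => j _; congr (_ * (_)%:E)%E.
  have -> : poisson_vec (m.+1%:R * r) (k + j) =
      poisson_vec r k + poisson_vec (m%:R * r) j.
    by rewrite /poisson_vec -scalerDl natrD -natr1; congr (_ *: _); ring.
  by rewrite !indicE; congr (_%:R); apply/idP/idP; rewrite !inE.
rewrite (@nneseries_cauchy_product R (poisson_weight r) (poisson_weight (m%:R * r))
  (fun k => (\1_A (poisson_vec (m.+1%:R * r) k))%:E)%E)//; last 2 first.
- by move=> k; exact/poisson_weight_ge0/ltW.
- by move=> k; exact/poisson_weight_ge0.
apply: eq_eseriesr => i _; rewrite poisson_weight_conv.
by rewrite -natr1 mulrDl mul1r addrC.
Qed.

Lemma infinitely_divisible_poisson_law : infinitely_divisible (poisson_law 1).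
Proof.
move=> n n0; exists (poisson_law n%:R^-1) => A mA.
have rn : 0 < n%:R^-1 :> R by rewrite invr_gt0 ltr0n.
by rewrite conv_pow_poisson_law// poisson_lawE// mulfV// pnatr_eq0 -lt0n.
Qed.

End poisson_vector.

(** * Moments and transforms of the Poisson law of mean 1 *)

Section poisson_one.
Context (R : realType).
Let N : probability nat R := poisson_prob 1 0.

Lemma poisson1_mean : (\int[N]_k (k%:R)%:E = 1)%E.
Proof.
have := @ge0_poisson_stein R 1 (fun=> 1) ltr01 (fun=> ler01).
under eq_integral do rewrite mulr1.
by move=> ->; rewrite mul1e integral_cst//= mul1e probability_setT.
Qed.

Lemma integrable_poisson1_id : N.-integrable setT (EFin \o (fun k => k%:R)).
Proof.
apply/integrableP; split; first by [].
under eq_integral do rewrite /= ger0_norm//.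
by rewrite poisson1_mean ltry.
Qed.

Lemma poisson1_second_moment : (\int[N]_k (k%:R ^+ 2)%:E = 2)%E.
Proof.
have := @ge0_poisson_stein R 1 (fun k => k%:R) ltr01 (fun k => ler0n R k).
under eq_integral do rewrite -expr2.
move=> ->; rewrite mul1e.
under eq_integral do rewrite -natr1 EFinD.
rewrite ge0_integralD//.
by rewrite poisson1_mean integral_cst//= mul1e probability_setT.
Qed.

Lemma integrable_poisson1_sqr : N.-integrable setT (EFin \o (fun k => k%:R ^+ 2)).
Proof.
apply/integrableP; split; first by [].
under eq_integral do rewrite /= ger0_norm ?sqr_ge0//.
by rewrite poisson1_second_moment ltry.
Qed.

Lemma poisson1_stein (h : nat -> R) : (forall k, `|h k| <= 1) ->
  \int[N]_k (k%:R * h k) = \int[N]_k h k.+1.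
Proof.
move=> h1.
(* The identity is available for nonnegative functions, so it is applied to [1 + h], and the
   constant part, known from the mean, is subtracted. *)
have h0 k : 0 <= 1 + h k by have := h1 k; rewrite ler_norml => /andP[]; lra.
have := congr1 fine (@ge0_poisson_stein R 1 _ ltr01 h0).
rewrite mul1e -[LHS]/(\int[N]_k (k%:R * (1 + h k))) -[RHS]/(\int[N]_k (1 + h k.+1)).
have ikh : N.-integrable setT (EFin \o (fun k => k%:R * h k)).
  apply: (integrable_dominated _ integrable_poisson1_id); first by [].
  by move=> k; rewrite normrM ger0_norm// ler_piMr.
under eq_Rintegral do rewrite mulrDr mulr1.
rewrite RintegralD//; last exact: integrable_poisson1_id.
rewrite RintegralD//; last 2 first.
- exact: finite_measure_integrable_cst.
- by apply: (integrable_bounded N (M := 1)) => //; by [].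
rewrite Rintegral_prob_cst (_ : \int[N]_k k%:R = 1); first by move=> /addrI.
by rewrite /Rintegral poisson1_mean.
Qed.

Let c (u : R) := \int[N]_k cos (u * k%:R).
Let s (u : R) := \int[N]_k sin (u * k%:R).

Let ic u : N.-integrable setT (EFin \o (fun k => cos (u * k%:R))).
Proof.
apply: (integrable_bounded N (M := 1)); first by [].
by move=> k; exact: cos_max.
Qed.

Let isn u : N.-integrable setT (EFin \o (fun k => sin (u * k%:R))).
Proof.
apply: (integrable_bounded N (M := 1)); first by [].
by move=> k; exact: sin_max.
Qed.

(** Together with [ds] this is [phi'(u) = i e^(i u) phi(u)]: differentiation brings down a factor
    [k], which the Stein identity trades for a shift by one. *)
Let dc (u : R) : is_derive u 1 c (- (sin u * c u + cos u * s u)).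
Proof.
apply: is_derive1_eq.
  apply: (@is_derive_Rintegral _ _ R N (fun u k => cos (u * k%:R))
    (fun u k => - sin (u * k%:R) * k%:R) (fun k => k%:R)) => //.
  - move=> v k; eapply is_derive1_eq; first by derive_fun.
    by rewrite /=; ring.
  - exact: integrable_poisson1_id.
  - by move=> v k _; rewrite normrM normrN (ger0_norm (ler0n R k)) ler_piMl// sin_max.
transitivity (- \int[N]_k (k%:R * sin (u * k%:R))).
  rewrite -mulN1r -RintegralZl//; last first.
    apply: (integrable_dominated _ integrable_poisson1_id); first by [].
    by move=> k; rewrite normrM ger0_norm// ler_piMr// sin_max.
  by apply: eq_Rintegral => k _; ring.
rewrite (poisson1_stein (h := fun k => sin (u * k%:R))); last by move=> k; exact: sin_max.
congr -%R; rewrite /c /s -!RintegralZl// -RintegralD//; last 2 first.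
- exact: integrableZl (ic u).
- exact: integrableZl (isn u).
by apply: eq_Rintegral => k _; rewrite -natr1 mulrDr mulr1 sinD; ring.
Qed.

Let ds (u : R) : is_derive u 1 s (cos u * c u - sin u * s u).
Proof.
apply: is_derive1_eq.
  apply: (@is_derive_Rintegral _ _ R N (fun u k => sin (u * k%:R))
    (fun u k => cos (u * k%:R) * k%:R) (fun k => k%:R)) => //.
  - move=> v k; eapply is_derive1_eq; first by derive_fun.
    by rewrite /=; ring.
  - exact: integrable_poisson1_id.
  - by move=> v k _; rewrite normrM (ger0_norm (ler0n R k)) ler_piMl// cos_max.
transitivity (\int[N]_k (k%:R * cos (u * k%:R))).
  by apply: eq_Rintegral => k _; ring.
rewrite (poisson1_stein (h := fun k => cos (u * k%:R))); last by move=> k; exact: cos_max.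
rewrite /c /s -!RintegralZl// -RintegralB//; last 2 first.
- exact: integrableZl (ic u).
- exact: integrableZl (isn u).
by apply: eq_Rintegral => k _; rewrite -natr1 mulrDr mulr1 cosD; ring.
Qed.

(** [G + i H] is [exp (- e^(i u)) phi(u)], whose derivative vanishes, so it keeps its value [e^(-1)]
    at 0. *)
Lemma poisson1_char (u : R) :
  \int[N]_k cos (u * k%:R) = expR (cos u - 1) * cos (sin u) /\
  \int[N]_k sin (u * k%:R) = expR (cos u - 1) * sin (sin u).
Proof.
pose G v := expR (- cos v) * (c v * cos (sin v) + s v * sin (sin v)).
pose H v := expR (- cos v) * (s v * cos (sin v) - c v * sin (sin v)).
have dG (v : R) : is_derive v 1 G 0.
  rewrite /G; eapply is_derive1_eq.
    derive_fun; try exact: dc; try exact: ds.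
  by rewrite /=; ring.
have dH (v : R) : is_derive v 1 H 0.
  rewrite /H; eapply is_derive1_eq.
    derive_fun; try exact: dc; try exact: ds.
  by rewrite /=; ring.
have c0 : c 0 = 1.
  by rewrite /c; under eq_Rintegral do rewrite mul0r cos0; rewrite Rintegral_prob_cst.
have s0 : s 0 = 0.
  by rewrite /s; under eq_Rintegral do rewrite mul0r sin0; rewrite Rintegral_prob_cst.
have GE : G u = expR (-1).
  rewrite (@is_derive_0_is_cst R G u 0 dG) /G c0 s0 cos0 sin0 cos0 sin0; ring.
have HE : H u = 0.
  rewrite (@is_derive_0_is_cst R H u 0 dH) /H c0 s0 cos0 sin0 cos0 sin0; ring.
have cs := cos2Dsin2 (sin u).
have e1 : expR (cos u) * expR (- cos u) = 1 by rewrite -expRD subrr expR0.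
have cE : c u = expR (cos u) * (cos (sin u) * G u - sin (sin u) * H u).
  rewrite /G /H -[LHS]mul1r -[X in X * _ = _]cs -[LHS]mul1r -[X in X * _ = _]e1; ring.
have sE : s u = expR (cos u) * (sin (sin u) * G u + cos (sin u) * H u).
  rewrite /G /H -[LHS]mul1r -[X in X * _ = _]cs -[LHS]mul1r -[X in X * _ = _]e1; ring.
rewrite -/(c u) -/(s u) cE sE GE HE expRD; split; ring.
Qed.

(** Exponential tilting: [e^(a k)] times the weights of rate 1 is [e^(e^a - 1)] times the weights of
    rate [e^a], which sum to 1. *)
Lemma poisson1_mgf (a : R) :
  (\int[N]_k (expR (a * k%:R))%:E = (expR (expR a - 1))%:E)%E.
Proof.
rewrite ge0_integral_poisson//.
transitivity ((expR (expR a - 1))%:E * \sum_(0 <= k <oo) (poisson_weight (expR a) k)%:E)%E.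
  rewrite -nneseriesZl; last first.
    by move=> k _; rewrite lee_fin poisson_weight_ge0// expR_ge0.
  apply: eq_eseriesr => k _; rewrite -!EFinM; congr (_%:E).
  rewrite /poisson_weight expr1n expRD (mulrC a) expRM_natl.
  rewrite -[expR (expR a) * _ * _]mulrA.
  transitivity (expR a ^+ k / k`!%:R * expR (-1) * (expR (expR a) * expR (- expR a))).
    by rewrite -expRD subrr expR0; ring.
  by ring.
by rewrite poisson_weight_sum ?expR_gt0// mule1.
Qed.

End poisson_one.

(** * Sharpness of the factor 1/3 *)

Lemma expR_ge_cubic (R : realType) (z : R) : 0 <= z ->
  1 + z + z ^+ 2 / 2 + z ^+ 3 / 6 <= expR z.
Proof.
pose g2 (y : R) := 1 + y + y * y / 2 - expR y.
pose g3 (y : R) := 1 + y + y * y / 2 + y * (y * y) / 6 - expR y.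
have g2_le0 y : 0 <= y -> g2 y <= 0.
  move=> y0; have -> : 0 = g2 0 by rewrite /g2 expR0; ring.
  apply: (@le0_is_derive_nincr R g2 (fun y => 1 + y - expR y) 0) => // x.
    by rewrite /g2; eapply is_derive1_eq; [derive_fun|rewrite /=; field].
  by rewrite subr_le0 expR_ge1Dx.
move=> z0; rewrite -subr_le0 (_ : _ - _ = g3 z); last by rewrite /g3; ring.
have -> : 0 = g3 0 by rewrite /g3 expR0; ring.
apply: (@le0_is_derive_nincr R g3 g2 0) => // x.
by rewrite /g3 /g2; eapply is_derive1_eq; [derive_fun|rewrite /=; field].
Qed.


Section poisson_extremal.
Context (R : realType) (d : nat) (v : 'rV[R]_d).
Hypothesis v1 : dotv v v = 1.
Let N : probability nat R := poisson_prob 1 0.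
Let X : {RV N >-> 'rV[R]_d} := poisson_vec v 1.

Let dotX t k : dotv t (X k) = (k%:R - 1) * dotv t v.
Proof. by rewrite dotvC dotvZl dotvC. Qed.

Let poisson1_centered_sqr :
  N.-integrable setT (EFin \o (fun k => (k%:R - 1) ^+ 2)) /\
  \int[N]_k ((k%:R - 1) ^+ 2) = 1.
Proof.
have i2 := integrable_poisson1_sqr R.
have i1 := integrable_poisson1_id R.
have im1 : N.-integrable setT (EFin \o (fun k => (-2) * k%:R)) := integrableZl measurableT _ i1.
have ic : N.-integrable setT (EFin \o (fun=> 1)) by exact: finite_measure_integrable_cst.
have i12 : N.-integrable setT (EFin \o (fun k => (-2) * k%:R + 1)) := integrableD measurableT im1 ic.
have E k : (k%:R - 1) ^+ 2 = k%:R ^+ 2 + ((-2) * k%:R + 1) :> R by ring.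
split.
  rewrite (_ : _ \o _ = (EFin \o (fun k => k%:R ^+ 2)) \+ (EFin \o (fun k => (-2) * k%:R + 1))).
    exact: integrableD.
  by apply/funext => k; rewrite /= E EFinD.
under eq_Rintegral do rewrite E.
rewrite RintegralD// RintegralD// RintegralZl// Rintegral_prob_cst.
by rewrite /Rintegral poisson1_mean poisson1_second_moment/=; ring.
Qed.

Lemma poisson_centered : centered X.
Proof.
move=> i; rewrite unlock.
transitivity (\int[N]_k ((v 0 i)%:E * (k%:R - 1)%:E))%E.
  by apply: eq_integral => k _; rewrite -EFinM /= mxE mulrC.
have i1 := integrable_poisson1_id R.
have ic : N.-integrable setT (EFin \o (fun=> 1)) by exact: finite_measure_integrable_cst.
rewrite integralZl//; last exact: (integrableB measurableT i1 ic).
under eq_integral do rewrite EFinB.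
rewrite integralB//.
by rewrite poisson1_mean integral_cst//= probability_setT mule1 subee// mule0.
Qed.

Lemma poisson_finite_second_moment : finite_second_moment X.
Proof.
rewrite /finite_second_moment unlock.
have [i2 _] := poisson1_centered_sqr.
rewrite (_ : integral _ _ _ = \int[N]_k `|((k%:R - 1) ^+ 2)%:E|)%E.
  by have /integrableP[] := i2.
apply: eq_integral => k _ /=; rewrite ger0_norm ?sqr_ge0//.
by rewrite dotX dotvC dotX v1 mulr1 expr2.
Qed.

Lemma poisson_variance_form : variance_form X v = 1.
Proof.
rewrite (variance_formE poisson_centered poisson_finite_second_moment).
under eq_Rintegral do rewrite dotX v1 mulr1.
by have [_] := poisson1_centered_sqr.
Qed.

Lemma poisson_log_mgf (s : R) : log_mgf X (s *: v) = (expR s - 1 - s)%:E.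
Proof.
rewrite log_mgfE -[RHS]expeRK; congr (lne _).
under eq_integral do rewrite dotX v1 mulr1 mulrBr mulr1 expRD EFinM muleC.
rewrite ge0_integralZl//. 
by rewrite poisson1_mgf -EFinM -expRD addrC.
Qed.

(** At [s = 1/3 - c] the cubic lower bound of [e^s] and the pole bound give
    [(1 + s/3) (1 - c s) <= 1], that is [s (1/3 - c) <= c s^2 / 3]. By the choice of [s] the left
    side is [s^2], which would force [c >= 3]. *)
Lemma poisson_not_pole_bound (c : R) : 0 <= c -> c < 1 / 3 -> ~ pole_bound X v c.
Proof.
move=> c0 c3 h; pose s := 1 / 3 - c.
have s0 : 0 < s by rewrite /s; lra.
have cs : c * s < 1 by rewrite /s; nra.
have sc : (s%:E < c%:E^-1)%E.
  rewrite inver; case: eqP => [_|/eqP cN]; first exact: ltry.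
  have cp : 0 < c by rewrite lt_neqAle eq_sym cN.
  by rewrite lte_fin -[c^-1]mul1r ltr_pdivlMr// mulrC.
have := h s (ltW s0) sc.
rewrite poisson_log_mgf poisson_variance_form lee_fin mul1r => e1.
have e2 := expR_ge_cubic (ltW s0).
have d0 : 0 < 2 * (1 - c * s) by rewrite mulr_gt0// subr_gt0.
have e3 : s ^+ 2 / 2 + s ^+ 3 / 6 <= s ^+ 2 / (2 * (1 - c * s)) by lra.
move: e3; rewrite ler_pdivlMr//.
have -> : (s ^+ 2 / 2 + s ^+ 3 / 6) * (2 * (1 - c * s)) =
   s ^+ 2 * (1 + s * (1 / 3 - c) - c * s ^+ 2 / 3) by field.
rewrite -/s -[leRHS]mulr1 ler_pM2l ?exprn_gt0//.
have : 0 < s ^+ 2 * (1 - c / 3) by rewrite mulr_gt0 ?exprn_gt0//; lra.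
by rewrite expr2; lra.
Qed.

Lemma jump_radius_dirac t :
  (jump_radius (\d_v : {measure set 'rV[R]_d -> \bar R}) t <= (Num.max (dotv t v) 0)%:E)%E.
Proof.
apply: ge_ereal_sup => _ [x [xS|->] <-]; last first.
  by rewrite dotvC dotv0l maxxx lee_fin le_max lexx orbT.
suff -> : x = v by [].
apply/eqP/negPn/negP => xv.
have oU : open (~` [set v]).
  apply: closed_openC; apply: accessible_closed_set1.
  exact/hausdorff_accessible/norm_hausdorff.
have : (~` [set v]) x by exact/eqP.
by move=> /(xS _ oU); rewrite /= diracE memNset ?ltxx// => /(_ erefl).
Qed.

Let rint_dirac (f : 'rV[R]_d -> R) : measurable_fun setT f ->
  \int[\d_v]_x f x = f v.
Proof.
move=> mf; rewrite /Rintegral integral_dirac//; first by rewrite diracT mul1e.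
exact/measurable_EFinP.
Qed.

Lemma levy_measure_poisson :
  levy_measure (distribution N X) (\d_v : {measure set 'rV[R]_d -> \bar R}).
Proof.
have mD := @measurable_unit_ball R d.
split.
- rewrite /= diracE memNset// => /= v0.
  by move: v1; rewrite v0 dotv0l => /eqP; rewrite eq_sym oner_eq0.
- rewrite integral_dirac//; first by rewrite diracT mul1e ltry.
  by apply/measurable_EFinP/measurable_minr => //; exact: measurable_dotvv.
(* The only jump is [v], which lies on the boundary of the closed unit ball and is therefore
   compensated; the compensator is exactly the centring, so no drift remains. *)
exists 0, 0; split.
- exact: trmx0.
- by move=> t; rewrite /quad mulmx0 mul0mx mxE.
move=> t; rewrite /char_fun /levy_exponent /cexp /=.
have mt := measurable_dotv t.
rewrite !rint_dirac; last 2 first.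
- by mfun.
- by mfun.
have -> : quad 0 t = 0 by rewrite /quad mulmx0 mul0mx mxE.
have -> : dotv t 0 = 0 by rewrite dotvC dotv0l.
rewrite indicE mem_set/= ?v1// mulr1 oppr0 mul0r !add0r.
set u := dotv t v.
have cX (f : R -> R) : measurable_fun setT f -> (forall x, `|f x| <= 1) ->
    \int[distribution N X]_x f (dotv t x) = \int[N]_k f (u * k%:R - u).
  move=> mf f1; rewrite /Rintegral integral_distribution//.
  - congr fine; apply: eq_integral => k _ /=.
    by rewrite dotX -/u; congr ((f _)%:E); ring.
  - by apply/measurable_EFinP; exact: measurableT_comp.
  - apply: (@integrable_bounded _ _ _ N (fun k => f (dotv t (X k))) 1) => // x; exact: f1.
rewrite (cX cos (continuous_measurable_fun (@continuous_cos R)) (@cos_max R)).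
rewrite (cX sin (continuous_measurable_fun (@continuous_sin R)) (@sin_max R)).
have [cE sE] := poisson1_char u.
have icos : N.-integrable setT (EFin \o (fun k => cos (u * k%:R))).
  by apply: (integrable_bounded N (M := 1)) => // k; exact: cos_max.
have isin : N.-integrable setT (EFin \o (fun k => sin (u * k%:R))).
  by apply: (integrable_bounded N (M := 1)) => // k; exact: sin_max.
have ibnd (f : nat -> R) (a : R) : (forall k, `|f k| <= 1) -> `|a| <= 1 ->
    N.-integrable setT (EFin \o (fun k => f k * a)).
  move=> f1 a1; apply: (integrable_bounded N (M := 1)) => // k.
  by rewrite normrM mulr_ile1.
congr (complex.Complex _ _).
  under eq_Rintegral do rewrite cosB.
  rewrite RintegralD//; last 2 first.
  + by apply: ibnd => [k|]; exact: cos_max.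
  + by apply: ibnd => [k|]; exact: sin_max.
  by rewrite !RintegralZr// cE sE cosB; ring.
under eq_Rintegral do rewrite sinB.
rewrite RintegralB//; last 2 first.
+ by apply: ibnd => [k|]; [exact: sin_max|exact: cos_max].
+ by apply: ibnd => [k|]; [exact: cos_max|exact: sin_max].
by rewrite !RintegralZr// cE sE sinB; ring.
Qed.

End poisson_extremal.

(** A positive dimension provides the unit vector [v]; in dimension 0 both sides of the bound vanish
    and every [k] would do. *)
Lemma radial_pole_factor_ge (R : realType) (d : nat) (k : R) : (0 < d)%N ->
  (forall (disp : measure_display) (Omega : measurableType disp)
      (P : probability Omega R) (X : {RV P >-> 'rV[R]_d})
      (nu : {measure set 'rV[R]_d -> \bar R}),
    infinitely_divisible (distribution P X) ->
    levy_measure (distribution P X) nu ->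
    centered X ->
    finite_second_moment X ->
    (forall t : 'rV[R]_d, (jump_radius nu t < +oo)%E) ->
    forall t : 'rV[R]_d, (radial_pole X t <= k%:E * jump_radius nu t)%E) ->
  1 / 3 <= k.
Proof.
move=> d0 h; rewrite leNgt; apply/negP => k3.
pose v : 'rV[R]_d := delta_mx 0 (Ordinal d0).
have v1 : dotv v v = 1.
  rewrite dotvE (bigD1 (Ordinal d0))//= big1 ?addr0.
    by rewrite !mxE !eqxx mulr1.
  by move=> j /negPf j0; rewrite !mxE j0 andbF mulr0.
have jr t := jump_radius_dirac v t.
have := h _ _ _ (poisson_vec v 1) _ (infinitely_divisible_poisson_law v)
  (levy_measure_poisson v1) (poisson_centered v)
  (poisson_finite_second_moment v1) (fun t => le_lt_trans (jr t) (ltry _)) v.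
have j0 : (0 <= jump_radius (\d_v : {measure set 'rV[R]_d -> \bar R}) v)%E.
  apply: ereal_sup_ubound; exists 0; first by right.
  by rewrite dotvC dotv0l maxxx.
(* [k] may be negative and the jump radius is only bounded above by 1, so the comparison passes
   through [max k 0]. *)
have kj : (k%:E * jump_radius (\d_v : {measure set 'rV[R]_d -> \bar R}) v <=
    (Num.max k 0)%:E)%E.
  apply: (@le_trans _ _ ((Num.max k 0)%:E * jump_radius (\d_v : {measure set 'rV[R]_d -> \bar R}) v)%E).
    by apply: lee_wpmul2r => //; rewrite lee_fin le_max lexx.
  rewrite -[leRHS]mule1; apply: lee_wpmul2l.
    by rewrite lee_fin le_max lexx orbT.
  by apply: le_trans (jr v) _; rewrite v1 lee_fin ge_max lexx ler01.
move=> /le_trans /(_ kj); rewrite /radial_pole poisson_variance_form// ltr01.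
have k13 : Num.max k 0 < 1 / 3 by rewrite gt_max k3; lra.
move=> /le_lt_trans; rewrite -lte_fin in k13; move=> /(_ _ k13).
move=> /ereal_inf_lt[_ [c [c0 pc] <-]]; rewrite lte_fin => c3.
exact: (poisson_not_pole_bound v1 c0 c3 pc).
Qed.

Theorem theorem3p4 (R : realType) (d : nat) :
  (forall (disp : measure_display) (Omega : measurableType disp)
      (P : probability Omega R) (X : {RV P >-> 'rV[R]_d})
      (nu : {measure set 'rV[R]_d -> \bar R}),
    infinitely_divisible (distribution P X) ->
    levy_measure (distribution P X) nu ->
    centered X ->
    finite_second_moment X ->
    mgf_domain X 0 ->
    forall t : 'rV[R]_d,
      (minkowski_functional (mgf_domain X) t <= radial_pole X t)%E /\
      (radial_pole X t <= jump_radius nu t / 3%:E)%E) /\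
  ((0 < d)%N ->
    ~ exists k : R, k < 1 / 3 /\
      forall (disp : measure_display) (Omega : measurableType disp)
        (P : probability Omega R) (X : {RV P >-> 'rV[R]_d})
        (nu : {measure set 'rV[R]_d -> \bar R}),
      infinitely_divisible (distribution P X) ->
      levy_measure (distribution P X) nu ->
      centered X ->
      finite_second_moment X ->
      (forall t : 'rV[R]_d, (jump_radius nu t < +oo)%E) ->
      forall t : 'rV[R]_d, (radial_pole X t <= k%:E * jump_radius nu t)%E).
Proof.
split.
  move=> disp Omega P X nu _ levy cX sX dom0 t; split.
    exact: minkowski_le_radial_pole.
  exact: radial_pole_le_jump_radius.
move=> d0 [k [k3 h]]; have := radial_pole_factor_ge d0 h.
by rewrite leNgt k3.
Qed.
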